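(* Let $d\in\mathbb N$, let $A$ be a real $d\times d$ diagonalizable matrix with positive eigenvalues, whose distinct eigenvalues are $0<\lambda_1<\lambda_2<\dots<\lambda_{d_*}$. Let $F:\mathbb R^d\to\mathbb R^d$ be locally Lipschitz with $F(0)=0$, and assume that $F$ satisfies one of the following: (H1) there exist numbers $\beta_k\in(1,\infty)$, $k\in\mathbb N$, strictly increasing to infinity, and functions $F_k\in\mathcal H_{\beta_k}(\mathbb R^d)\cap C^\infty(\mathbb R^d\setminus\{0\})$, $k\in\mathbb N$, such that for every $N\in\mathbb N$, $\left|F(x)-\sum_{k=1}^N F_k(x)\right|=\mathcal O(|x|^\beta)$ as $x\to0$, for some $\beta>\beta_N$; (H2) there exist $N_*\in\mathbb N$, strictly increasing numbers $\beta_1,\dots,\beta_{N_*}\in(1,\infty)$, and functions $F_k\in\mathcal H_{\beta_k}(\mathbb R^d)\cap C^\infty(\mathbb R^d\setminus\{0\})$, $1\le k\le N_*$, such that $\left|F(x)-\sum_{k=1}^{N_*}F_k(x)\right|=\mathcal O(|x|^\beta)$ as $x\to0$, for all $\beta>\beta_{N_*}$. Let $y\in C^1([0,\infty),\mathbb R^d)$ be a solution of $y'+Ay=F(y)$ for $t>0$, with $y(0)\neq0$ and $\lim_{t\to\infty}y(t)=0$. Then there exist an eigenvalue $\lambda_*=\lambda_{n_0}$ of $A$ and a corresponding eigenvector $\xi_*$ (so $A\xi_*=\lambda_*\xi_*$, $\xi_*\ne0$) with $|y(t)-e^{-\lambda_*t}\xi_*|=\mathcal O(e^{-(\lambda_*+\delta)t})$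 for some $\delta>0$, and, with $\alpha_r$, $\tilde\mu_n$, $\mu_n$ and $\mathcal F_{r,m}$ defined from $\lambda_*,\xi_*,(\beta_k),(F_k)$ as in the context, there exist polynomials $q_n:\mathbb R\to\mathbb R^d$, $n\in\mathbb N$, such that $$y(t)\sim\sum_{n=1}^\infty q_n(t)e^{-\mu_nt}\quad\text{in }\mathbb R^d,$$ that is, for every $N\ge1$ there is $\varepsilon_N>0$ with $\left|y(t)-\sum_{n=1}^Nq_n(t)e^{-\mu_nt}\right|=\mathcal O(e^{-(\mu_N+\varepsilon_N)t})$ as $t\to\infty$; and for every $n\ge1$, $$q_n'+(A-\mu_nI_d)q_n=\sum_{\substack{r\ge1,\ m\ge0,\ k_1,\dots,k_m\ge2,\\ \sum_{j=1}^m\tilde\mu_{k_j}+\alpha_r\lambda_*=\tilde\mu_n}}\mathcal F_{r,m}(q_{k_1},q_{k_2},\dots,q_{k_m})\quad\text{in }\mathbb R,$$ where in case (H2) the index $r$ is restricted to $1\le r\le N_*$.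
   Context: $|\cdot|$ is the Euclidean norm; $\mathbb Z_+=\{0,1,2,\dots\}$; $I_d$ is the identity matrix. For $t$-dependent functions, $f(t)=\mathcal O(h(t))$ means $|f(t)|\le Ch(t)$ for all sufficiently large $t$, for some $C>0$; ''$f(x)=\mathcal O(h(x))$ as $x\to0$'' means there are $r,C>0$ with $|f(x)|\le Ch(x)$ for all $|x|<r$. $\mathcal H_\beta(\mathbb R^d)$ is the set of functions $G:\mathbb R^d\to\mathbb R^d$ that are positively homogeneous of degree $\beta\ge0$: $G(tx)=t^\beta G(x)$ for all $x\in\mathbb R^d$, $t>0$. ''$G\in C^\infty(U)$'' means that the restriction of $G$ to the open set $U$ is infinitely differentiable. Exponents. Put $\alpha_k=\beta_k-1>0$. In case (H1) let $$\tilde S=\Big\{\sum_{k=n_0}^{d_*}m_k(\lambda_k-\lambda_* )+\sum_{j=1}^\infty z_j\alpha_j\lambda_*:\ m_k,z_j\in\mathbb Z_+,\ z_j>0\text{ for only finitely many }j\Big\},$$ and in case (H2) let $$\tilde S=\Big\{\sum_{k=n_0}^{d_*}m_k(\lambda_k-\lambda_* )+\sum_{j=1}^{N_*}z_j\alpha_j\lambda_*:\ m_k,z_j\in\mathbb Z_+\Big\}.$$ Arrange the (countably infinite) set $\tilde S\subset[0,\infty)$ as a strictly increasing sequence $(\tilde\mu_n)_{n=1}^\infty$ (so $\tilde\mu_1=0$ and $\tilde\mu_n\to\infty$), and set $\mu_n=\tilde\mu_n+\lambda_*$. Taylor coefficients. For $m\ge0$, $\mathcal F_{r,m}=\frac1{m!}D^mF_r(\xi_*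 )$, where $D^mF_r(\xi_* )$ is the $m$-th order derivative of $F_r$ at $\xi_*$, an $m$-linear map $(\mathbb R^d)^m\to\mathbb R^d$ for $m\ge1$, and $\mathcal F_{r,0}=F_r(\xi_* )$. In the sum defining the equation for $q_n$, one sums over all $r$, $m$ and ordered tuples $(k_1,\dots,k_m)$ satisfying the constraint (a finite sum); for $m=0$ there are no indices $k_j$, the constraint reads $\alpha_r\lambda_*=\tilde\mu_n$, and the term is $F_r(\xi_* )$. An empty sum is zero. *)

(* Defs.v *)
From HB Require Import structures.
From mathcomp Require Import all_boot all_order all_algebra.
From mathcomp Require Import all_classical all_reals all_analysis.
Set Implicit Arguments.
Unset Strict Implicit.
Unset Printing Implicit Defensive.
Import Order.TTheory GRing.Theory Num.Theory.
Import numFieldNormedType.Exports.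
Local Open Scope classical_set_scope.
Local Open Scope ring_scope.

(* Families written (beta_k)_{k >= 1}, (F_k)_{k >= 1}, (q_n)_{n >= 1}, ... in
   the mathematical text are indexed here from 0: [beta k] is beta_{k+1}, etc. *)

(* The library norm [`| x |] on matrices is the sup norm; estimates below are
   stated with the Euclidean norm. *)
Definition enorm (R : realType) (d : nat) (x : 'cV[R]_d) : R :=
  Num.sqrt (\sum_(i < d) x i 0 ^+ 2).

Definition bigO_at0 (R : realType) (d : nat)
    (f : 'cV[R]_d -> 'cV[R]_d) (h : 'cV[R]_d -> R) : Prop :=
  exists r C : R, [/\ 0 < r, 0 < C &
    forall x, enorm x < r -> enorm (f x) <= C * h x].

Definition bigO_atoo (R : realType) (d : nat)
    (f : R -> 'cV[R]_d) (h : R -> R) : Prop :=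
  exists2 C : R, 0 < C & \forall t \near +oo, enorm (f t) <= C * h t.

(* Being locally Lipschitz does not depend on the norm of R^d. *)
Definition locally_lipschitz (R : realType) (d : nat)
    (F : 'cV[R]_d -> 'cV[R]_d) : Prop :=
  forall x : 'cV[R]_d, exists2 U : set 'cV[R]_d, nbhs x U & [lipschitz F z | z in U].

Definition pos_homogeneous (R : realType) (d : nat) (beta : R)
    (G : 'cV[R]_d -> 'cV[R]_d) : Prop :=
  forall (x : 'cV[R]_d) (t : R), 0 < t -> G (t *: x) = t `^ beta *: G x.

(* [iter_diff G [:: v_1; ...; v_m] x] is D^m G(x)(v_1, ..., v_m), where
   D^m G = D (D^(m-1) G) is the iterated Frechet derivative. *)
Fixpoint iter_diff (R : realType) (d : nat) (G : 'cV[R]_d -> 'cV[R]_d)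
    (vs : seq 'cV[R]_d) : 'cV[R]_d -> 'cV[R]_d :=
  if vs is v :: vs' then fun x => 'd (iter_diff G vs') x v else G.

(* In finite dimension, the multilinear-map-valued D^m G is differentiable
   exactly when its evaluation at each fixed (v_1, ..., v_m) is. *)
Definition smooth_on (R : realType) (d : nat) (U : set 'cV[R]_d)
    (G : 'cV[R]_d -> 'cV[R]_d) : Prop :=
  forall (vs : seq 'cV[R]_d) (x : 'cV[R]_d),
    U x -> differentiable (iter_diff G vs) x.

(* F_{r,m}(v_1, ..., v_m) for G = F_r and m = size vs *)
Definition taylor_coef (R : realType) (d : nat) (G : 'cV[R]_d -> 'cV[R]_d)
    (xi : 'cV[R]_d) (vs : seq 'cV[R]_d) : 'cV[R]_d :=
  ((size vs)`!%:R)^-1 *: iter_diff G vs xi.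

Definition H1 (R : realType) (d : nat) (F : 'cV[R]_d -> 'cV[R]_d)
    (beta : nat -> R) (Fr : nat -> 'cV[R]_d -> 'cV[R]_d) : Prop :=
  [/\ forall k, 1 < beta k,
      forall k l, (k < l)%N -> beta k < beta l,
      beta @ \oo --> +oo,
      forall k, pos_homogeneous (beta k) (Fr k) /\ smooth_on (~` [set 0]) (Fr k)
    & forall N : nat, exists2 b : R, beta N < b &
        bigO_at0 (fun x => F x - \sum_(k < N.+1) Fr k x)
                 (fun x => enorm x `^ b)].

(* Only the values of [beta] and [Fr] at indices below [Nstar] matter. *)
Definition H2 (R : realType) (d : nat) (F : 'cV[R]_d -> 'cV[R]_d)
    (Nstar : nat) (beta : nat -> R)
    (Fr : nat -> 'cV[R]_d -> 'cV[R]_d) : Prop :=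
  [/\ (0 < Nstar)%N,
      forall k, (k < Nstar)%N -> 1 < beta k,
      forall k l, (k < l < Nstar)%N -> beta k < beta l,
      forall k, (k < Nstar)%N ->
        pos_homogeneous (beta k) (Fr k) /\ smooth_on (~` [set 0]) (Fr k)
    & forall b : R, beta Nstar.-1 < b ->
        bigO_at0 (fun x => F x - \sum_(k < Nstar) Fr k x)
                 (fun x => enorm x `^ b)].

(* [None] stands for case (H1), [Some Nstar] for case (H2). *)
Definition expansion (R : realType) (d : nat) (F : 'cV[R]_d -> 'cV[R]_d)
    (K : option nat) (beta : nat -> R)
    (Fr : nat -> 'cV[R]_d -> 'cV[R]_d) : Prop :=
  if K is Some Nstar then H2 F Nstar beta Fr else H1 F beta Fr.

Definition term_indices (K : option nat) : set nat :=
  if K is Some Nstar then [set r | (r < Nstar)%N] else setT.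

Definition alpha (R : realType) (beta : nat -> R) (k : nat) : R := beta k - 1.

(* [\sum_(j \in _)] is 0 on infinite supports, hence the explicit finiteness
   condition on z; it is automatic for K = Some Nstar. *)
Definition Stilde (R : realType) (dstar : nat) (lam : 'I_dstar -> R)
    (n0 : 'I_dstar) (K : option nat) (beta : nat -> R) : set R :=
  [set s | exists (m : 'I_dstar -> nat) (z : nat -> nat),
     finite_set [set j | term_indices K j /\ (0 < z j)%N] /\
     s = \sum_(k < dstar | (n0 <= k)%N) (m k)%:R * (lam k - lam n0)
         + \sum_(j \in term_indices K) (z j)%:R * alpha beta j * lam n0].

Definition increasing_enumeration (R : realType) (S : set R)
    (u : nat -> R) : Prop :=
  (forall n p, (n < p)%N -> u n < u p) /\ range u = S.

(* y is C^1 on [0, +oo[, the derivative at 0 being one-sided; the values of y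
   on negative reals are irrelevant. *)
Definition C1_halfline (R : realType) (d : nat) (y : R -> 'cV[R]_d) : Prop :=
  exists dy : R -> 'cV[R]_d,
    {within [set t : R | 0 <= t], continuous dy} /\
    forall t : R, 0 <= t ->
      h^-1 *: (y (h + t) - y t) @[h --> within [set h | 0 <= h + t] 0^']
        --> dy t.

(* Polynomials R -> R^d are column vectors of polynomials. *)
Definition vhorner (R : realType) (d : nat) (q : 'cV[{poly R}]_d) (t : R) :
  'cV[R]_d := map_mx (fun p : {poly R} => p.[t]) q.

Definition vderiv (R : realType) (d : nat) (q : 'cV[{poly R}]_d) :
  'cV[{poly R}]_d := map_mx (@deriv R) q.

(* Tuples (r, (k_1, ..., k_m)) over which the equation for q_n sums; since
   indices start at 0, the constraint k_j >= 2 reads 1 <= k_j. *)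
Definition resonant (R : realType) (K : option nat) (beta : nat -> R)
    (lamstar : R) (mutilde : nat -> R) (n : nat) : set (nat * seq nat) :=
  [set rk | [/\ term_indices K rk.1,
                all (fun k => 1 <= k)%N rk.2
              & \sum_(k <- rk.2) mutilde k + alpha beta rk.1 * lamstar
                = mutilde n]].

(* Main.v *)
Require Import Defs.
From HB Require Import structures.
From mathcomp Require Import all_boot all_order all_algebra.
From mathcomp Require Import all_classical all_reals all_analysis.
From mathcomp Require Import ring lra.
Set Implicit Arguments.
Unset Strict Implicit.
Unset Printing Implicit Defensive.
Import Order.TTheory GRing.Theory Num.Theory.
Import numFieldNormedType.Exports.
Local Open Scope classical_set_scope.
Local Open Scope ring_scope.

(** In coordinates diagonalizing [A] the equation becomes a family of scalar
equations [w' = - lam w + g], coupled only through the forcing [g], and every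
asymptotic statement is read off from one fact ([linear_ode_decay]): if
[g = O(e^(-bt))] and [b <> lam], then [w = c e^(-lam t) + O(e^(-bt))] for some
constant [c].

Leading term.  Near 0 the nonlinearity is superlinear, [|F x| <= C |x|^b] with
[b > 1] ([expansion_superlinear]).  The energy estimates give some exponential
decay of [y]; feeding a decay rate [a] into the scalar equations either
produces a nonzero coefficient [c], hence the leading term, or improves the
rate by a fixed factor ([decay_bootstrap]).  The improvement cannot go on
forever, because the energy satisfies [E' >= - c E] near 0 and so decays at most
exponentially; the same inequality shows that [y] never vanishes
([leading_term]).

Higher terms.  Write [y = e^(-lam t) (xi + h)] with [h -> 0].  By homogeneity
[F_r y = e^(-beta_r lam t) F_r (xi + h)], and since [xi <> 0] the function [F_r]
can be expanded at [xi] by Taylor's formula ([taylor_bound]).  If [h] is known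
up to the exponent [mt N], inserting it into the multilinear Taylor terms gives
[F y] up to the next exponent [mt N.+1]: one factor [e^(-alpha_r lam t)] with
[alpha_r lam > 0] is gained, and the exponents that occur stay in the additive
set [Stilde] ([nonlinear_expansion]).  The remainder of [y] then solves a linear
equation with forcing [p(t) e^(-mu t)] plus a smaller error, where [mu] is the
next exponent.  Its scalar components are a polynomial times [e^(-mu t)] up to
a smaller error, since no eigenvalue lies strictly between two consecutive
exponents ([scalar_resonance_step], [expansion_step]).  This yields [q_(N+1)]
together with its equation, and dependent choice gives the whole sequence
([full_expansion]). *)

(** * Exponential decay rates *)

Section Decay.
Context {R : realType}.
Implicit Types (V : normedModType R) (a b : R).

Definition expdecay V (f : R -> V) (b : R) : Prop :=
  exists2 C : R, 0 < C & \forall t \near +oo, `|f t| <= C * expR (- b * t).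

(** The strict version absorbs polynomial factors: they cost an arbitrarily
    small part of the rate, which is why every remainder below is measured in
    this way. *)
Definition sdecay V (f : R -> V) (a : R) : Prop :=
  exists2 b : R, a < b & expdecay f b.

Lemma expdecay_le V (f : R -> V) (g : R -> R) b :
  (\forall t \near +oo, `|f t| <= `|g t|) -> expdecay g b -> expdecay f b.
Proof.
move=> fg [C C0 gC]; exists C => //; near=> t.
apply: (@le_trans _ _ `|g t|); first by near: t.
by near: t.
Unshelve. all: by end_near. Qed.

Lemma eq_expdecay V (f g : R -> V) b :
  (\forall t \near +oo, f t = g t) -> expdecay g b -> expdecay f b.
Proof.
move=> fg [C C0 gC]; exists C => //; near=> t.
rewrite (_ : f t = g t); last by near: t.
by near: t.
Unshelve. all: by end_near. Qed.

Lemma eq_sdecay V (f g : R -> V) a :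
  (\forall t \near +oo, f t = g t) -> sdecay g a -> sdecay f a.
Proof. by move=> fg [b ab gb]; exists b => //; exact: eq_expdecay gb. Qed.

Lemma expdecay_weaken V (f : R -> V) b c : c <= b -> expdecay f b -> expdecay f c.
Proof.
move=> cb [C C0 fC]; exists C => //; near=> t.
apply: (@le_trans _ _ (C * expR (- b * t))); first by near: t.
rewrite ler_pM2l// ler_expR.
have t0 : 0 <= t by near: t; exact: nbhs_pinfty_ge.
by rewrite ler_wpM2r// lerN2.
Unshelve. all: by end_near. Qed.

Lemma sdecayW V (f : R -> V) a : sdecay f a -> expdecay f a.
Proof. by move=> [b ab]; apply: expdecay_weaken; exact: ltW. Qed.

Lemma sdecay_weaken V (f : R -> V) a c : c <= a -> sdecay f a -> sdecay f c.
Proof. by move=> ca [b ab fb]; exists b => //; exact: le_lt_trans ab. Qed.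

Lemma expdecay0 V b : expdecay (fun=> 0 : V) b.
Proof.
by exists 1 => //; near=> t; rewrite normr0 mul1r expR_ge0.
Unshelve. all: by end_near. Qed.

Lemma expdecayD V (f g : R -> V) b :
  expdecay f b -> expdecay g b -> expdecay (fun t => f t + g t) b.
Proof.
move=> [C C0 fC] [D D0 gD]; exists (C + D); first exact: addr_gt0.
near=> t; rewrite mulrDl (le_trans (ler_normD _ _))// lerD//; by near: t.
Unshelve. all: by end_near. Qed.

Lemma expdecayN V (f : R -> V) b : expdecay f b -> expdecay (fun t => - f t) b.
Proof. by move=> [C C0 fC]; exists C => //; near=> t; rewrite normrN; near: t.
Unshelve. all: by end_near. Qed.

Lemma expdecayB V (f g : R -> V) b :
  expdecay f b -> expdecay g b -> expdecay (fun t => f t - g t) b.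
Proof. by move=> fb gb; apply: expdecayD => //; exact: expdecayN. Qed.

Lemma sdecay0 V a : sdecay (fun=> 0 : V) a.
Proof. by exists (a + 1); [rewrite ltrDl | exact: expdecay0]. Qed.

Lemma sdecayD V (f g : R -> V) a :
  sdecay f a -> sdecay g a -> sdecay (fun t => f t + g t) a.
Proof.
move=> [b ab fb] [c ac gc]; exists (Num.min b c); first by rewrite lt_min ab.
by apply: expdecayD; [apply: expdecay_weaken fb|apply: expdecay_weaken gc];
  rewrite ge_min lexx ?orbT.
Qed.

Lemma expdecay_sum V (I : eqType) (s : seq I) (P : pred I) (f : I -> R -> V) b :
  (forall i, i \in s -> P i -> expdecay (f i) b) ->
  expdecay (fun t => \sum_(i <- s | P i) f i t) b.
Proof.
elim: s => [_|i s IH fb].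
  by apply: eq_expdecay (expdecay0 V b); near=> t; rewrite big_nil.
have IHs : expdecay (fun t => \sum_(i <- s | P i) f i t) b.
  by apply: IH => j js; apply: fb; rewrite inE js orbT.
have [Pi|nPi] := boolP (P i).
  apply: (@eq_expdecay _ _ (fun t => f i t + \sum_(i <- s | P i) f i t)).
    by near=> t; rewrite big_cons Pi.
  by apply: expdecayD => //; apply: fb => //; exact: mem_head.
by apply: eq_expdecay IHs; near=> t; rewrite big_cons (negbTE nPi).
Unshelve. all: by end_near. Qed.

Lemma sdecay_sum V (I : eqType) (s : seq I) (P : pred I) (f : I -> R -> V) a :
  (forall i, i \in s -> P i -> sdecay (f i) a) ->
  sdecay (fun t => \sum_(i <- s | P i) f i t) a.
Proof.
elim: s => [_|i s IH fb].
  by apply: eq_sdecay (sdecay0 V a); near=> t; rewrite big_nil.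
have IHs : sdecay (fun t => \sum_(i <- s | P i) f i t) a.
  by apply: IH => j js; apply: fb; rewrite inE js orbT.
have [Pi|nPi] := boolP (P i).
  apply: (@eq_sdecay _ _ (fun t => f i t + \sum_(i <- s | P i) f i t)).
    by near=> t; rewrite big_cons Pi.
  by apply: sdecayD => //; apply: fb => //; exact: mem_head.
by apply: eq_sdecay IHs; near=> t; rewrite big_cons (negbTE nPi).
Unshelve. all: by end_near. Qed.

Lemma expdecay_exp a : expdecay (fun t : R => expR (- a * t)) a.
Proof. by exists 1 => //; near=> t; rewrite mul1r ger0_norm ?expR_ge0.
Unshelve. all: by end_near. Qed.

Lemma expdecay_cst V (v : V) : expdecay (fun=> v) 0.
Proof.
exists (`|v| + 1); first by rewrite ltr_wpDl.
by near=> t; rewrite oppr0 mul0r expR0 mulr1 lerDl.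
Unshelve. all: by end_near. Qed.

Lemma expdecayZ V (f : R -> R) (g : R -> V) a b :
  expdecay f a -> expdecay g b -> expdecay (fun t => f t *: g t) (a + b).
Proof.
move=> [C C0 fC] [D D0 gD]; exists (C * D); first exact: mulr_gt0.
near=> t; rewrite normrZ opprD mulrDl expRD mulrACA ler_pM//; by near: t.
Unshelve. all: by end_near. Qed.

Lemma expdecayM (f g : R -> R) a b :
  expdecay f a -> expdecay g b -> expdecay (fun t => f t * g t) (a + b).
Proof. exact: (@expdecayZ R). Qed.

Lemma expdecayZl V (k : R) (g : R -> V) b :
  expdecay g b -> expdecay (fun t => k *: g t) b.
Proof.
by move=> /(expdecayZ (@expdecay_cst R k)); rewrite add0r.
Qed.

Lemma sdecayZ V (f : R -> R) (g : R -> V) a b :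
  expdecay f a -> sdecay g b -> sdecay (fun t => f t *: g t) (a + b).
Proof.
by move=> fa [c bc gc]; exists (a + c); [rewrite ltrD2l|exact: expdecayZ].
Qed.

Lemma expdecay_id (e : R) : 0 < e -> expdecay (fun t : R => t) (- e).
Proof.
move=> e0; exists e^-1; first by rewrite invr_gt0.
near=> t; have t0 : 0 <= t by near: t; exact: nbhs_pinfty_ge.
rewrite ger0_norm// opprK ler_pdivlMl// (le_trans _ (expR_ge1Dx _))//.
by rewrite lerDr.
Unshelve. all: by end_near. Qed.

Lemma expdecay_poly (p : {poly R}) (e : R) : 0 < e ->
  expdecay (fun t : R => p.[t]) (- e).
Proof.
elim/poly_ind: p e => [|p c IH] e e0.
  by apply: eq_expdecay (expdecay0 R _); near=> t; rewrite horner0.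
apply: (@eq_expdecay _ _ (fun t => p.[t] * t + c)).
  by near=> t; rewrite !hornerE.
apply: expdecayD; last first.
  by apply: expdecay_weaken (expdecay_cst c); rewrite oppr_le0 ltW.
have e2 : 0 < e / 2 by rewrite divr_gt0.
have := expdecayM (IH _ e2) (expdecay_id e2).
by rewrite -opprD -splitr.
Unshelve. all: by end_near. Qed.

(** Subexponential factors, in particular polynomials, cost less than any gap
    between the rates. *)
Lemma sdecay_expZ V (f : R -> V) a b : (forall e, 0 < e -> expdecay f (- e)) ->
  b < a -> sdecay (fun t => expR (- a * t) *: f t) b.
Proof.
move=> fe ba; exists ((a + b) / 2); first by rewrite addrC midf_lt.
have e0 : 0 < (a - b) / 2 by rewrite divr_gt0// subr_gt0.
have := expdecayZ (expdecay_exp a) (fe _ e0).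
by have -> : a + - ((a - b) / 2) = (a + b) / 2 by lra.
Qed.

Lemma coord_le_norm m n (x : 'M[R]_(m, n)) i j : `|x i j| <= `|x|.
Proof.
rewrite [leRHS]/Num.Def.normr/= mx_normrE.
exact: (le_bigmax _ (fun ij => `|x ij.1 ij.2|) (i, j)).
Qed.

Lemma norm_le_coord m n (x : 'M[R]_(m, n)) (M : R) : 0 <= M ->
  (forall i j, `|x i j| <= M) -> `|x| <= M.
Proof.
move=> M0 xM; rewrite [leLHS]/Num.Def.normr/= mx_normrE.
by apply: bigmax_le => // -[i j] _; exact: xM.
Qed.

Lemma expdecay_coord m n (f : R -> 'M[R]_(m, n)) b :
  expdecay f b <-> forall i j, expdecay (fun t => f t i j) b.
Proof.
split=> [[C C0 fC] i j|fb].
  exists C => //; near=> t; apply: (le_trans (coord_le_norm _ _ _)).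
  by near: t.
have /choice [C CP] : forall ij : 'I_m * 'I_n, exists C, 0 < C /\
    \forall t \near +oo, `|f t ij.1 ij.2| <= C * expR (- b * t).
  by move=> ij; have [C C0 fC] := fb ij.1 ij.2; exists C.
exists (1 + \sum_ij C ij).
  by rewrite ltr_pwDl// sumr_ge0// => ij _; rewrite ltW//; case: (CP ij).
near=> t; apply: norm_le_coord => [|i j].
  by rewrite mulr_ge0 ?expR_ge0// addr_ge0// sumr_ge0// => ij _;
    rewrite ltW//; case: (CP ij).
apply: (@le_trans _ _ (C (i, j) * expR (- b * t))).
  move: i j; near: t.
  have : \forall t \near +oo, forall ij : 'I_m * 'I_n,
      `|f t ij.1 ij.2| <= C ij * expR (- b * t).
    by apply: filter_forall => ij; case: (CP ij).
  by apply: filterS => t H i j; exact: (H (i, j)).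
rewrite ler_wpM2r ?expR_ge0// (bigD1 (i, j))//= addrCA lerDl addr_ge0//.
by rewrite sumr_ge0// => ij _; rewrite ltW//; case: (CP ij).
Unshelve. all: by end_near. Qed.

Lemma sdecay_coord m n (f : R -> 'M[R]_(m, n)) a :
  (forall i j, sdecay (fun t => f t i j) a) -> sdecay f a.
Proof.
move=> fa.
have /choice [b bP] : forall ij : 'I_m * 'I_n, exists b, a < b /\
    expdecay (fun t => f t ij.1 ij.2) b.
  by move=> ij; have [b ? ?] := fa ij.1 ij.2; exists b.
pose c := \big[Num.min/(a + 1)]_ij b ij.
exists c.
  rewrite /c; elim/big_ind: _ => [|x y ax ay|ij _]; first by rewrite ltrDl.
    by rewrite lt_min ax.
  by case: (bP ij).
apply/expdecay_coord => i j; apply: expdecay_weaken (proj2 (bP (i, j))).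
exact: bigmin_le.
Qed.

Lemma expdecay_mulmx m n p (P : 'M[R]_(m, n)) (f : R -> 'M[R]_(n, p)) b :
  expdecay f b -> expdecay (fun t => P *m f t) b.
Proof.
move=> /expdecay_coord fb; apply/expdecay_coord => i j.
apply: (@eq_expdecay _ _ (fun t => \sum_k P i k *: f t k j)).
  by near=> t; rewrite mxE.
by apply: expdecay_sum => k _ _; exact: expdecayZl.
Unshelve. all: by end_near. Qed.

Lemma sdecay_mulmx m n p (P : 'M[R]_(m, n)) (f : R -> 'M[R]_(n, p)) b :
  sdecay f b -> sdecay (fun t => P *m f t) b.
Proof. by move=> [c bc fc]; exists c => //; exact: expdecay_mulmx. Qed.

End Decay.

(** * Scalar linear equations with decaying forcing *)

Section ScalarODE.
Context {R : realType}.
Implicit Types (lam mu a b : R) (w g : R -> R).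

Lemma is_derive_expRM (k t : R) :
  is_derive t 1 (fun s => expR (k * s)) (k * expR (k * t)).
Proof.
have h : is_derive t (1 : R) (fun s : R => k * s) k.
  by apply: is_derive_eq; rewrite /GRing.scale/= mulr1.
by have := is_derive1_comp (is_derive_expR (k * t)) h; rewrite mulrC.
Qed.

Lemma nincr_of_derive (f df : R -> R) (s t : R) : s <= t ->
  (forall x, s <= x <= t -> is_derive x 1 f (df x)) ->
  (forall x, s <= x <= t -> df x <= 0) -> f t <= f s.
Proof.
move=> st fdf df0.
have [x||c] := @MVT_segment R f df s t st.
- by rewrite in_itv/= => /andP[/ltW ? /ltW ?]; apply: fdf; apply/andP.
- apply: derivable_within_continuous => x; rewrite in_itv/= => xst.
  by case: (fdf _ xst).
rewrite in_itv/= => cst e; rewrite -subr_le0 e.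
by rewrite mulr_le0_ge0 ?subr_ge0// df0.
Qed.

(** With [W = w e^(lam t)] the equation reads [W' = O(e^((lam - b) t))]. The
    right-hand side is dominated by the derivative of [E = e^((lam - b) t)] up
    to a constant factor, so that for a suitable [k] the function [W + k E] is
    nonincreasing and [W - k E] is nondecreasing. When [b < lam] this bounds
    [W] by a multiple of [E]; when [lam < b] both functions squeeze a common
    limit [c]. *)
Lemma linear_ode_decay lam b w g : b != lam ->
  (\forall t \near +oo, is_derive t (1 : R) w (- lam * w t + g t)) ->
  expdecay g b ->
  exists c, expdecay (fun t => w t - c * expR (- lam * t)) b.
Proof.
move=> blam [T [_ wT]] [C C0 [T' [_ gT']]].
pose M := Num.max (Num.max T T') 0.
have MT t : M < t -> T < t by rewrite !gt_max => /andP[/andP[]].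
have MT' t : M < t -> T' < t by rewrite !gt_max => /andP[/andP[]].
have M0 t : M < t -> 0 < t by rewrite gt_max => /andP[].
pose W t := w t * expR (lam * t).
pose E t := expR ((lam - b) * t).
have dW t : M < t -> is_derive t 1 W (g t * expR (lam * t)).
  move=> /MT/wT dw; have de := is_derive_expRM lam t.
  have := @is_deriveM _ _ _ _ _ _ _ _ dw de.
  by move/is_derive_eq; apply; rewrite /GRing.scale/=; ring.
have dE (k t : R) : is_derive t 1 (fun s => k * E s) (k * ((lam - b) * E t)).
  have := @is_deriveZ _ _ _ _ k _ _ _ (is_derive_expRM (lam - b) t).
  exact.
have gE t : M < t -> `|g t * expR (lam * t)| <= C * E t.
  move=> /MT'/gT' gt; rewrite normrM (ger0_norm (expR_ge0 _)).
  rewrite (le_trans (ler_wpM2r (expR_ge0 _) gt))// -mulrA -expRD /E.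
  by rewrite -mulrDl (addrC (- b)).
(* chosen so that the derivative of [k E] is [- C E], whatever the sign of [b
   - lam] *)
pose k := C / (b - lam).
have kE t : k * ((lam - b) * E t) = - C * E t.
  rewrite /k; field; by rewrite subr_eq0.
have up s t : M < s -> s <= t -> W t + k * E t <= W s + k * E s.
  move=> Ms st.
  apply: (@nincr_of_derive (fun t => W t + k * E t)
    (fun t => g t * expR (lam * t) - C * E t)) => // x /andP[sx _];
    have {s sx Ms st}Mt := lt_le_trans Ms sx; move: x Mt => {}t Mt.
    have := @is_deriveD _ _ _ _ _ _ _ _ _ (dW _ Mt) (dE k t).
    by move/is_derive_eq; apply; rewrite kE mulNr.
  by rewrite subr_le0 (le_trans (ler_norm _))// gE.
have lo s t : M < s -> s <= t -> W s - k * E s <= W t - k * E t.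
  move=> Ms st; rewrite -lerN2.
  apply: (@nincr_of_derive (fun t => - (W t - k * E t))
    (fun t => - (g t * expR (lam * t) + C * E t))) => // x /andP[sx _];
    have {s sx Ms st}Mt := lt_le_trans Ms sx; move: x Mt => {}t Mt.
    have := @is_deriveN _ _ _ _ _ _ _
      (@is_deriveB _ _ _ _ _ _ _ _ _ (dW _ Mt) (dE k t)).
    by move/is_derive_eq; apply; rewrite kE mulNr opprK.
  rewrite oppr_le0 -lerBlDr sub0r.
  by have := gE t Mt; rewrite ler_norml => /andP[].
(* [c = 0] when [b < lam], and otherwise the supremum of [W - k E] *)
have [c cP] : exists c K, forall t, M + 1 < t -> `|W t - c| <= K * E t.
  have [blt|lamb] : b < lam \/ lam < b by case: ltgtP blam; auto.
    exists 0, (`|W (M + 1)| + `|k|) => t Mt; rewrite subr0.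
    have Ms : M < M + 1 by rewrite ltrDl.
    have Mt' := lt_trans Ms Mt.
    have k0 : k < 0 by rewrite /k nmulr_llt0// ?subr_lt0// invr_lt0 subr_lt0.
    have E1 : 1 <= E t.
      by rewrite /E -expR0 ler_expR mulr_ge0 ?subr_ge0 ?ltW// M0.
    have Es : 0 <= E (M + 1) by exact: expR_ge0.
    have kEs : k * E (M + 1) <= 0 by rewrite mulr_le0_ge0// ltW.
    have := up _ _ Ms (ltW Mt); have := lo _ _ Ms (ltW Mt).
    have WE : `|W (M + 1)| <= `|W (M + 1)| * E t by rewrite ler_peMr.
    have /andP[] : - `|W (M + 1)| <= W (M + 1) <= `|W (M + 1)|.
      by rewrite -ler_norml.
    rewrite mulrDl (ltr0_norm k0) mulNr ler_norml => *.
    by apply/andP; split; lra.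
  pose S := [set W s - k * E s | s in [set s | M < s]].
  have k0 : 0 < k by rewrite divr_gt0// subr_gt0.
  have ubS t : M < t -> ubound S (W t + k * E t).
    move=> Mt _ [s /= Ms <-].
    have Ekt u : 0 <= k * E u by rewrite mulr_ge0 ?expR_ge0// ltW.
    have [st|/ltW ts] := leP s t.
      by rewrite (le_trans (lo _ _ Ms st))// lerD2l (ge0_cp (Ekt t)).
    by rewrite (le_trans _ (up _ _ Mt ts))// lerD2l (ge0_cp (Ekt s)).
  exists (sup S), k => t Mt1; have Mt : M < t by rewrite (lt_trans _ Mt1)// ltrDl.
  have S0 : S !=set0 by exists (W t - k * E t), t.
  have : sup S <= W t + k * E t by apply: ge_sup => //; exact: ubS.
  have : W t - k * E t <= sup S.
    by apply: ub_le_sup; [exists (W t + k * E t); exact: ubS|exists t].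
  by rewrite ler_norml => *; apply/andP; split; lra.
exists c; case: cP => K cK.
exists (`|K| + 1); first by rewrite ltr_wpDl.
exists (M + 1); split; first exact: num_real.
move=> t Mt; have -> : w t - c * expR (- lam * t) = (W t - c) * expR (- lam * t).
  by rewrite /W mulrBl -mulrA -expRD mulNr subrr expR0 mulr1.
rewrite normrM (ger0_norm (expR_ge0 _)).
rewrite (le_trans (ler_wpM2r (expR_ge0 _) (cK _ Mt)))//.
have -> : K * E t * expR (- lam * t) = K * expR (- b * t).
  by rewrite -mulrA /E -expRD; congr (_ * expR _); ring.
by rewrite ler_wpM2r ?expR_ge0// (le_trans (ler_norm _))// lerDl.
Qed.

(** For [k = 0] this is integration of coefficients; for [k <> 0] the equation
    is solved by [p / k] up to [- p' / k], of smaller degree. *)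
Lemma poly_ode_solvable (k : R) (p : {poly R}) :
  exists q : {poly R}, q^`() + k *: q = p.
Proof.
have [->|k0] := eqVneq k 0.
  exists (\poly_(i < (size p).+1) (p`_i.-1 / i%:R)).
  rewrite scale0r addr0; apply/polyP => i; rewrite coef_deriv coef_poly ltnS.
  have [ip|pi] := ltnP; last by rewrite mul0rn nth_default.
  by rewrite -[LHS]mulr_natr /= divfK// pnatr_eq0.
have [n] := ubnP (size p); elim: n p => // n IH p; rewrite ltnS => pn.
have [->|p0] := eqVneq p 0.
  by exists 0; rewrite deriv0 scaler0 addr0.
have [|q qE] := IH (- k^-1 *: p^`()).
  apply: leq_trans pn; apply: leq_ltn_trans (size_scale_leq _ _) _.
  exact: lt_size_deriv.
exists (k^-1 *: p + q); rewrite derivD derivZ scalerDr scalerA divff// scale1r.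
by rewrite addrACA qE scaleNr addrAC subrr add0r.
Qed.

(** An exponential cannot decay faster than its own rate; this identifies
    coefficients. *)
Lemma exp_coef_eq0 lam b (c : R) : lam < b ->
  expdecay (fun t : R => c * expR (- lam * t)) b -> c = 0.
Proof.
move=> lb [C C0 [M [_ MC]]]; apply/eqP/negPn/negP => c0.
have c1 : 0 < `|c| by rewrite normr_gt0.
have bl : 0 < b - lam by rewrite subr_gt0.
pose t := Num.max (M + 1) (C / (`|c| * (b - lam))).
have Mt : M < t by rewrite lt_max ltrDl ltr01.
have := MC _ Mt; rewrite normrM (ger0_norm (expR_ge0 _)) leNgt => /negP; apply.
have -> : - lam * t = - b * t + (b - lam) * t by ring.
rewrite expRD mulrCA mulrC ltr_pM2l ?expR_gt0//.
apply: lt_le_trans (ler_wpM2l (ltW c1) (expR_ge1Dx _)).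
rewrite mulrDr mulr1 -ltrBlDl; apply: (@lt_le_trans _ _ C).
  by rewrite ltrBlDl ltrDr.
by rewrite mulrA -ler_pdivrMl ?mulr_gt0// mulrC le_max lexx orbT.
Qed.

(** Subtracting [e^(-mu t) q0], where [q0] is a polynomial particular solution,
    leaves an equation with forcing decaying faster than [e^(-mu t)]. The
    homogeneous part [c e^(-lam t)] that then appears is absorbed into [q0]
    when [lam = mu], is negligible when [lam > mu], and vanishes when [lam <
    mu], because [w] is assumed to decay faster than [e^(-lam t)]. *)
Lemma scalar_resonance_step lam mu a w g (p : {poly R}) :
  lam < a \/ mu <= lam -> expdecay w a -> sdecay g mu ->
  (\forall t \near +oo,
     is_derive t (1 : R) w (- lam * w t + (expR (- mu * t) * p.[t] + g t))) ->
  exists2 q : {poly R}, q^`() + (lam - mu) *: q = p &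
    sdecay (fun t => w t - expR (- mu * t) * q.[t]) mu.
Proof.
move=> lamP wa [c muc gc] wP.
have [q0 q0E] := poly_ode_solvable (lam - mu) p.
have polyd (q : {poly R}) b : b < mu ->
    expdecay (fun t => expR (- mu * t) * q.[t]) b.
  move=> bmu; apply: sdecayW.
  exact: (@sdecay_expZ _ R^o _ _ _ (expdecay_poly q) bmu).
(* a rate between [mu] and [c] that avoids [lam] and does not exceed it when
   [mu < lam], so that [e^(-lam t)] is negligible in that case *)
pose b := if mu < lam then Num.min c ((mu + lam) / 2) else c.
have bP : [/\ mu < b, b <= c, b != lam & mu < lam -> b < lam].
  rewrite /b; case: ifPn => [mulam|]; last first.
    by rewrite -leNgt => lammu; split=> //; rewrite gt_eqF// (le_lt_trans _ muc).
  have m := midf_lt mulam.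
  rewrite lt_min muc m.1 ge_min lexx; split=> //.
    by rewrite lt_eqF// gt_min m.2 orbT.
  by rewrite gt_min m.2 orbT.
case: bP => mub bc blam blam'.
pose v t := w t - expR (- mu * t) * q0.[t].
have vP : \forall t \near +oo, is_derive t (1 : R) v (- lam * v t + g t).
  apply: filterS wP => t dw.
  have := @is_deriveB _ _ _ _ _ _ _ _ _ dw (@is_deriveM _ _ _ _ _ _ _ _
    (is_derive_expRM (- mu) t) (is_derive_poly q0 t)).
  move/is_derive_eq; apply; rewrite /GRing.scale/= /v -q0E hornerD hornerZ.
  ring.
have [c0 c0P] := linear_ode_decay blam vP (expdecay_weaken bc gc).
have [lammu|mulam|lammu] := ltgtP lam mu; last 1 first.
- exists (q0 + c0%:P).
    by rewrite -q0E lammu subrr !scale0r !addr0 derivD derivC addr0.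
  exists b => //; apply: eq_expdecay c0P; near=> t.
  by rewrite /v hornerD hornerC lammu; ring.
- exists q0 => //.
  have lama : lam < a by case: lamP => //; rewrite leNgt lammu.
  have m := midf_lt lammu.
  have c00 : c0 = 0.
    apply: (@exp_coef_eq0 lam (Num.min a ((lam + mu) / 2))).
      by rewrite lt_min lama m.1.
    apply: (@eq_expdecay _ _ _ (fun t => v t - (v t - c0 * expR (- lam * t)))).
      by near=> t; ring.
    apply: expdecayB; last first.
      apply: expdecay_weaken c0P; rewrite ge_min; apply/orP; right.
      by rewrite ltW// (lt_trans m.2).
    apply: expdecayB; first by apply: expdecay_weaken wa; rewrite ge_min lexx.
    by apply: polyd; rewrite gt_min m.2 orbT.
  exists b => //; apply: eq_expdecay c0P; near=> t.
  by rewrite c00 mul0r subr0.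
exists q0 => //.
exists b => //; apply: (@eq_expdecay _ _ _
  (fun t => (v t - c0 * expR (- lam * t)) + c0 * expR (- lam * t))).
  by near=> t; rewrite subrK.
apply: expdecayD => //; apply: expdecay_weaken (expdecayZl c0 (expdecay_exp lam)).
exact/ltW/blam'.
Unshelve. all: by end_near. Qed.
End ScalarODE.

(** * Multilinear maps and Taylor's formula *)

Section Multilinear.
Context {R : realType} {d : nat}.
Local Notation V := 'cV[R]_d.
Implicit Types (T : seq V -> V) (x y : V) (l s : seq V).

(** Multilinearity in lists of any length at once: freezing the first entry
    ([multilinear_cons]) gives a map of the same kind, so that all proofs below
    are inductions on the length, expanding the head in the standard basis. *)
Definition multilinear T := forall l1 l2 (a : R) x y,
  T (l1 ++ (a *: x + y) :: l2) = a *: T (l1 ++ x :: l2) + T (l1 ++ y :: l2).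

Lemma multilinear_cons T x : multilinear T -> multilinear (fun l => T (x :: l)).
Proof. by move=> Tm l1 l2 a y z; exact: (Tm (x :: l1)). Qed.

Lemma multilinear_sum T l1 l2 (I : Type) (r : seq I) (c : I -> R) (v : I -> V) :
  multilinear T ->
  T (l1 ++ (\sum_(i <- r) c i *: v i) :: l2) = \sum_(i <- r) c i *: T (l1 ++ v i :: l2).
Proof.
move=> Tm; elim: r => [|i r IH]; last by rewrite !big_cons Tm IH.
rewrite !big_nil; have := Tm l1 l2 1 0 0; rewrite !scale1r addr0.
by move=> /eqP; rewrite addrC -subr_eq subrr eq_sym => /eqP.
Qed.

Definition basis_vec (i : 'I_d) : V := delta_mx i 0.

Lemma basis_expansion x : x = \sum_i x i 0 *: basis_vec i.
Proof.
by rewrite [LHS]matrix_sum_delta; apply: eq_bigr => i _; rewrite big_ord1.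
Qed.

Lemma multilinear_basis T l1 l2 x : multilinear T ->
  T (l1 ++ x :: l2) = \sum_i x i 0 *: T (l1 ++ basis_vec i :: l2).
Proof. by move=> Tm; rewrite {1}(basis_expansion x) multilinear_sum. Qed.

Lemma multilinear_scale_nseq T m (a : R) x : multilinear T ->
  T (nseq m (a *: x)) = a ^+ m *: T (nseq m x).
Proof.
elim: m T => [|m IH] T Tm /=; first by rewrite scale1r.
have := multilinear_sum [::] (nseq m (a *: x)) [:: tt] (fun=> a) (fun=> x) Tm.
rewrite !big_seq1 /= => ->.
by rewrite (IH _ (multilinear_cons x Tm)) scalerA -exprS.
Qed.

Lemma expdecay_multilinear T m (h : R -> V) : multilinear T ->
  expdecay h 0 -> expdecay (fun t => T (nseq m (h t))) 0.
Proof.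
elim: m T => [|m IH] T Tm h0 /=; first exact: expdecay_cst.
apply: (@eq_expdecay _ _ _
  (fun t => \sum_i h t i 0 *: T (basis_vec i :: nseq m (h t)))).
  by near=> t; rewrite -(multilinear_basis [::]).
apply: expdecay_sum => i _ _.
have hi : expdecay (fun t => h t i 0) 0 by move/expdecay_coord: h0; apply.
by have := expdecayZ hi (IH _ (multilinear_cons (basis_vec i) Tm) h0); rewrite addr0.
Unshelve. all: by end_near. Qed.

(** Telescoping one slot at a time: the head is changed from [h] to [k] at the
    cost of [h - k], then the tail by induction. *)
Lemma expdecay_multilinear_diff T m (h k : R -> V) b : multilinear T ->
  expdecay h 0 -> expdecay k 0 -> expdecay (fun t => h t - k t) b ->
  expdecay (fun t => T (nseq m (h t)) - T (nseq m (k t))) b.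
Proof.
move=> + h0 k0 hk; elim: m T => [|m IH] T Tm /=.
  by apply: eq_expdecay (expdecay0 _ _); near=> t; rewrite subrr.
apply: (@eq_expdecay _ _ _ (fun t => \sum_i
  ((h t - k t) i 0 *: T (basis_vec i :: nseq m (h t)) + k t i 0 *:
  (T (basis_vec i :: nseq m (h t)) - T (basis_vec i :: nseq m (k t)))))).
  near=> t; rewrite !(multilinear_basis [::] _ _ Tm)/= -sumrB.
  apply: eq_bigr => i _; rewrite !mxE scalerBl scalerBr addrA subrK.
  by [].
apply: expdecay_sum => i _ _; apply: expdecayD.
  have hi : expdecay (fun t => (h t - k t) i 0) b by move/expdecay_coord: hk; apply.
  have := expdecayZ hi (expdecay_multilinear m (multilinear_cons (basis_vec i) Tm) h0).
  by rewrite addr0.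
have ki : expdecay (fun t => k t i 0) 0 by move/expdecay_coord: k0; apply.
by have := expdecayZ ki (IH _ (multilinear_cons (basis_vec i) Tm)); rewrite add0r.
Unshelve. all: by end_near. Qed.

Lemma vhornerD (p q : 'cV[{poly R}]_d) t :
  vhorner (p + q) t = vhorner p t + vhorner q t.
Proof. by apply/matrixP => i j; rewrite !mxE hornerD. Qed.

Lemma vhorner_sum (I : Type) (r : seq I) (P : pred I) (p : I -> 'cV[{poly R}]_d) t :
  vhorner (\sum_(i <- r | P i) p i) t = \sum_(i <- r | P i) vhorner (p i) t.
Proof.
elim/big_rec2: _ => [|i x y _ <-]; last by rewrite vhornerD.
by apply/matrixP => i j; rewrite !mxE horner0.
Qed.

(** The coordinates of the arguments are polynomials in [t], and so is a
    multilinear expression in them. *)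
Lemma multilinear_vhorner T (qs : seq 'cV[{poly R}]_d) : multilinear T ->
  exists p, forall t, vhorner p t = T [seq vhorner q t | q <- qs].
Proof.
elim: qs T => [|q qs IH] T Tm.
  by exists (map_mx polyC (T [::])) => t; apply/matrixP => i j; rewrite !mxE hornerC.
have /choice [p pP] := fun i => IH _ (multilinear_cons (basis_vec i) Tm).
exists (\sum_i q i 0 *: p i) => t.
rewrite vhorner_sum /= (multilinear_basis [::] _ _ Tm); apply: eq_bigr => i _ /=.
by rewrite -pP; apply/matrixP => j k; rewrite !mxE hornerM.
Qed.

End Multilinear.

(** The words of length [m] over [s] index the terms of the expansion of an
    [m]-linear map at a sum over [s]; words that differ by a permutation stay
    distinct, as the map need not be symmetric. *)
Fixpoint words (I : Type) (s : seq I) (m : nat) : seq (seq I) :=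
  if m is n.+1 then [seq k :: w | k <- s, w <- words s n] else [:: [::]].

Lemma mem_words (I : eqType) (s : seq I) m (w : seq I) :
  (w \in words s m) = (size w == m) && all (mem s) w.
Proof.
elim: m w => [|m IH] w /=; first by rewrite inE; case: w.
apply/allpairsP/idP => [[[k v] /= [ks vw ->]]|].
  by move: vw; rewrite IH /= ks eqSS.
case: w => //= k v; rewrite eqSS => /andP[sv /andP[ks av]].
by exists (k, v); split=> //=; rewrite IH sv.
Qed.

Lemma uniq_words (I : eqType) (s : seq I) m : uniq s -> uniq (words s m).
Proof.
move=> us; elim: m => //= m IH; apply: allpairs_uniq => //.
by move=> [k v] [k' v'] _ _ /= [-> ->].
Qed.

Lemma multilinear_words (R : realType) d (T : seq 'cV[R]_d -> 'cV[R]_d)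
    (I : Type) (s : seq I) (c : I -> R) (v : I -> 'cV[R]_d) m : multilinear T ->
  T (nseq m (\sum_(k <- s) c k *: v k)) =
  \sum_(w <- words s m) (\prod_(k <- w) c k) *: T [seq v k | k <- w].
Proof.
elim: m T => [|m IH] T Tm /=; first by rewrite big_seq1 big_nil scale1r.
rewrite (multilinear_sum [::] _ _ _ _ Tm)/= big_allpairs_dep/=.
apply: eq_bigr => k _; rewrite (IH _ (multilinear_cons _ Tm)) scaler_sumr.
by apply: eq_bigr => w _; rewrite scalerA big_cons.
Qed.

Section Taylor.
Context {R : realType} {d : nat}.
Local Notation V := 'cV[R]_d.
Implicit Types (G : V -> V) (U : set V).

Lemma is_derive_coord m n (f : R -> 'M[R]_(m, n)) t df i j :
  is_derive t (1 : R) f df -> is_derive t (1 : R) (fun s => f s i j) (df i j).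
Proof.
move=> [fd <-]; rewrite derive_mx// mxE; apply: derivableP.
by move/derivable_mxP: fd.
Qed.

Lemma iter_diff_cat G vs ws : iter_diff G (vs ++ ws) = iter_diff (iter_diff G ws) vs.
Proof.
elim: vs => [|v vs IH]; first reflexivity.
rewrite cat_cons [LHS]/=.
rewrite IH.
reflexivity.
Qed.

Lemma smooth_iter_diff U G ws : smooth_on U G -> smooth_on U (iter_diff G ws).
Proof. by move=> GU vs x Ux; rewrite -iter_diff_cat; exact: GU. Qed.

(** The outermost derivative is linear in its direction by definition. For an
    inner slot, linearity holds at all points of the open set [U] by induction,
    and differentiation preserves an identity that holds near [x]. *)
Lemma iter_diff_multilinear U G x : open U -> smooth_on U G -> U x ->
  multilinear (fun vs => iter_diff G vs x).
Proof.
move=> oU GU Ux l1 l2 a v w; elim: l1 x Ux => [|u l1 IH] x Ux /=.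
  by rewrite linearP.
have e : \near x, iter_diff G (l1 ++ (a *: v + w) :: l2) x =
    (a \*: iter_diff G (l1 ++ v :: l2) + iter_diff G (l1 ++ w :: l2)) x.
  by near=> z; apply: IH; near: z; exact: open_nbhs_nbhs.
have GU' l := diff_derivable (v := u) (GU l _ Ux).
transitivity ('D_u (iter_diff G (l1 ++ (a *: v + w) :: l2)) x).
  exact: esym (deriveE u (GU _ _ Ux)).
rewrite (near_eq_derive _ e) deriveD; [|exact: derivableZ|exact: GU'].
rewrite deriveZ; last exact: GU'.
by congr (_ *: _ + _); exact: (deriveE u (GU _ _ Ux)).
Unshelve. all: by end_near. Qed.

(** Along the line the difference quotients of [G] are literally its
    directional ones. *)
Lemma is_derive_line G (x h : V) (s : R) : differentiable G (x + s *: h) ->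
  is_derive s (1 : R) (fun r => G (x + r *: h)) ('d G (x + s *: h) h).
Proof.
move=> Gd; have D := diff_derivable (v := h) Gd.
have dE := deriveE h Gd.
have E : (fun e : R => e^-1 *: (((fun r => G (x + r *: h)) \o shift s) (e *: 1) -
    G (x + s *: h))) = (fun e : R => e^-1 *: ((G \o shift (x + s *: h)) (e *: h) -
    G (x + s *: h))).
  apply/funext => r /=; congr (_ *: (G _ - _)).
  have -> : r *: (1 : R) = r by exact: mulr1.
  by rewrite scalerDl addrCA addrA.
split; first by rewrite /derivable E.
by rewrite -[RHS]dE /derive E.
Qed.

(** Induction on the order, with [G] varying. On the segment from [xi] to [xi +
    h], the derivative of the remainder of order [M + 1] of [G] is the sum over
    [i] of [h_i] times the remainder of order [M] of the partial derivative
    [d_i G], hence [O(|h|^(M+1))]; the mean value theorem concludes. *)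
Lemma taylor_bound U G xi M : open U -> U xi -> smooth_on U G ->
  exists r C : R, [/\ 0 < r, 0 < C & forall h : V, `|h| < r ->
    `|G (xi + h) - \sum_(m < M) m`!%:R^-1 *: iter_diff G (nseq m h) xi|
      <= C * `|h| ^+ M].
Proof.
move=> oU Uxi; elim: M G => [|M IH] G GU.
  have /differentiable_continuous/cvgrPdist_lt/(_ 1 ltr01) := GU [::] _ Uxi.
  move=> /nbhs_ballP[r /= r0 rP]; exists r, (`|G xi| + 1).
  split; [exact: r0|exact: ltr_wpDl|].
  move=> h hr; rewrite big_ord0 subr0 expr0 mulr1.
  rewrite -[G (xi + h)](subrK (G xi)) addrC (le_trans (ler_normD _ _))// lerD2l.
  rewrite distrC ltW//; apply: (rP (xi + h)).
  by rewrite -ball_normE /ball_/= opprD addrA subrr sub0r normrN.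
have /choice [r' /choice [C' rC]] :=
  fun i => IH _ (smooth_iter_diff [:: basis_vec i] GU).
have /nbhs_ballP[r0 /= r00 r0P] : nbhs xi U by exact: open_nbhs_nbhs.
pose r := \big[Num.min/r0]_i r' i.
have rpos : 0 < r.
  rewrite /r; elim/big_ind: _ => // [a b a0 b0|i _]; first by rewrite lt_min a0.
  by case: (rC i).
pose C := 1 + \sum_i C' i.
have C'0 i : 0 <= C' i by case: (rC i) => _ /ltW.
exists r, C; split; [exact: rpos|by rewrite ltr_pwDl// sumr_ge0|].
move=> h hr; apply: norm_le_coord => [|j k].
  by rewrite mulr_ge0// addr_ge0// sumr_ge0.
rewrite (ord1 k) {k}.
have Ul (s : R) : 0 <= s <= 1 -> U (xi + s *: h).
  move=> /andP[s0 s1]; apply: r0P.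
  rewrite -ball_normE /ball_/= opprD addrA subrr sub0r normrN normrZ ger0_norm//.
  apply: (le_lt_trans (ler_piMl _ s1)) => //.
  by apply: (lt_le_trans hr); exact: bigmin_le_id.
(* the Taylor polynomial along the segment, in the coordinate [j] *)
pose a m := m`!%:R^-1 * iter_diff G (nseq m h) xi j 0.
pose p : {poly R} := \poly_(m < M.+1) a m.
have dp : p^`() = \poly_(m < M) (m`!%:R^-1 * iter_diff G (nseq m.+1 h) xi j 0).
  apply/polyP => m; rewrite coef_deriv !coef_poly ltnS; case: ifP; rewrite ?mul0rn//.
  by move=> _; rewrite /a factS natrM invfM -mulrA -[LHS]mulr_natl mulVKf.
pose phi s := G (xi + s *: h) j 0 - p.[s].
have dphi (s : R) : 0 <= s <= 1 -> is_derive s (1 : R) phi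
    (('d G (xi + s *: h) h : V) j 0 - p^`().[s]).
  move=> s01; apply: is_deriveB; first apply: is_derive_coord.
    apply: is_derive_line; exact: (GU [::] _ (Ul _ s01)).
have [|||c] := @MVT R phi (fun s => ('d G (xi + s *: h) h : V) j 0 - p^`().[s]) 0 1.
- exact: ltr01.
- by move=> x; rewrite in_itv/= => /andP[/ltW ? /ltW ?]; apply: dphi; apply/andP.
- apply: derivable_within_continuous => x; rewrite in_itv/= => x01.
  by case: (dphi _ x01).
rewrite in_itv/= => /andP[/ltW c0 /ltW c1]; rewrite subr0 mulr1.
have -> : phi 0 = 0.
  rewrite /phi scale0r addr0 /p horner_poly big_ord_recl expr0 mulr1 big1 ?addr0.
    by rewrite /a fact0 invr1 mul1r subrr.
  by move=> i _; rewrite lift0 expr0n mulr0.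
have -> : phi 1 = (G (xi + h) -
    \sum_(m < M.+1) m`!%:R^-1 *: iter_diff G (nseq m h) xi) j 0.
  rewrite /phi scale1r /p horner_poly !mxE summxE; congr (_ - _).
  by apply: eq_bigr => m _; rewrite expr1n mulr1 mxE.
rewrite subr0 => ->.
have c01 : 0 <= c <= 1 by rewrite c0.
pose Gi i := iter_diff G [:: basis_vec i].
have -> : ('d G (xi + c *: h) h : V) j 0 - p^`().[c] =
    \sum_i h i 0 * (Gi i (xi + c *: h) -
      \sum_(m < M) m`!%:R^-1 *: iter_diff (Gi i) (nseq m (c *: h)) xi) j 0.
  have e1 : ('d G (xi + c *: h) h : V) j 0 = \sum_i h i 0 * Gi i (xi + c *: h) j 0.
    have := multilinear_basis [::] [::] h (iter_diff_multilinear oU GU (Ul _ c01)).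
    by move=> /= ->; rewrite summxE; apply: eq_bigr => i _; rewrite mxE.
  have e2 : p^`().[c] = \sum_i h i 0 * (\sum_(m < M) m`!%:R^-1 *:
      iter_diff (Gi i) (nseq m (c *: h)) xi) j 0.
    rewrite dp horner_poly.
    under [RHS]eq_bigr do rewrite summxE mulr_sumr.
    rewrite exchange_big; apply: eq_bigr => m _.
    have -> : nseq m.+1 h = nseq m h ++ [:: h].
      by rewrite -[[:: h]]/(nseq 1 h) -nseqD addn1.
    have := multilinear_basis (nseq m h) [::] h (iter_diff_multilinear oU GU Uxi).
    move=> ->; rewrite summxE mulr_sumr mulr_suml; apply: eq_bigr => i _.
    have Gm : multilinear (fun vs => iter_diff (Gi i) vs xi).
      apply: (iter_diff_multilinear oU _ Uxi); exact: smooth_iter_diff.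
    rewrite (multilinear_scale_nseq _ _ _ Gm) iter_diff_cat !mxE.
    by rewrite /Gi; ring.
  rewrite e1 e2 -sumrB; apply: eq_bigr => i _.
  by rewrite [in RHS]mxE [in RHS]mxE mulrBr.
rewrite (le_trans (ler_norm_sum _ _ _))//.
apply: (@le_trans _ _ (\sum_i C' i * `|h| ^+ M.+1)); last first.
  by rewrite -mulr_suml ler_wpM2r// lerDr.
apply: ler_sum => i _; rewrite normrM exprS mulrCA ler_pM// ?coord_le_norm//.
apply: (le_trans (coord_le_norm _ _ _)); have [_ _ rCi] := rC i.
have ch : `|c *: h| <= `|h| by rewrite normrZ ger0_norm// ler_piMl.
apply: (le_trans (rCi _ _)).
  by apply: (le_lt_trans ch); apply: (lt_le_trans hr); exact: bigmin_le.
by rewrite ler_wpM2l// lerXn2r ?nnegrE.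
Unshelve. all: by end_near. Qed.

End Taylor.

(** * The set of exponents and its enumeration *)

Section Enumeration.
Context {R : realType}.
Implicit Types (S : set R) (b : R).

Definition locally_finite S := forall b, finite_set (S `&` [set s | s <= b]).

Lemma finite_set_min (A : set R) : finite_set A -> A !=set0 ->
  exists2 m, A m & forall s, A s -> m <= s.
Proof.
move=> /finite_seqP[l ->] [x /= xl].
elim: l x xl => // y l IH x _.
case: l IH => [_|z l IH].
  by exists y => [|s]; rewrite /= ?mem_head// inE => /eqP ->.
have [|m ml mP] := IH z; first exact: mem_head.
exists (Num.min y m).
  by rewrite /= /Num.min; case: ifP; rewrite in_cons ?eqxx// => _; rewrite ml orbT.
move=> s /=; rewrite in_cons => /orP[/eqP ->|sl]; rewrite ge_min ?lexx//.
by rewrite mP ?orbT.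
Qed.

Lemma locally_finite_min S : locally_finite S -> S !=set0 ->
  exists2 m, S m & forall s, S s -> m <= s.
Proof.
move=> Sf [x Sx]; have [|m [Sm mx] mP] := finite_set_min (Sf x).
  by exists x; split => //=.
exists m => // s Ss; have [sx|/ltW xs] := leP s x; first exact: mP.
exact: le_trans xs.
Qed.

(** The sequence takes the minimum of the set, then repeatedly the least
    element above the current one. An element missed by it would bound
    infinitely many elements of the set. *)
Lemma locally_finite_enumeration S : locally_finite S ->
  (forall b, exists2 s, S s & b < s) -> exists u, increasing_enumeration S u.
Proof.
move=> Sf Sunb.
have S0 : S !=set0 by have [s] := Sunb 0; exists s.
have [m0 Sm0 m0P] := locally_finite_min Sf S0.
have /choice [next nextP] : forall x, exists y,
    [/\ S y, x < y & forall s, S s -> x < s -> y <= s].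
  move=> x; have [||y [Sy xy] yP] := @locally_finite_min (S `&` [set s | x < s]).
  - by move=> b; apply: sub_finite_set (Sf b) => s [[]].
  - by have [s] := Sunb x; exists s.
  by exists y; split => // s Ss xs; exact: yP.
pose u n := iter n next m0.
have uS n : S (u n) by case: n => [//|n]; case: (nextP (u n)).
have uincr n : u n < u n.+1 by case: (nextP (u n)).
have uhomo : {homo u : n p / (n < p)%N >-> n < p}.
  exact: homo_ltn lt_trans uincr.
exists u; split; first exact: uhomo.
apply/seteqP; split => [_ [n _ <-]//|s Ss].
have [//|us] := pselect (range u s).
have lts n : u n < s.
  elim: n => [|n IH]; rewrite lt_neqAle; apply/andP; split.
  - by apply/eqP => e; apply: us; exists 0%N.
  - exact: m0P.
  - by apply/eqP => e; apply: us; exists n.+1.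
  - by case: (nextP (u n)) => _ _; apply.
have uinj : injective u.
  by move=> n p unp; case: (ltngtP n p) => // /uhomo; rewrite unp ltxx.
have : finite_set (u @^-1` (S `&` [set r | r <= s])).
  by apply: finite_preimage (Sf s) => n p _ _; exact: uinj.
have -> : u @^-1` (S `&` [set r | r <= s]) = [set: nat].
  by apply/seteqP; split=> // n _; split=> //=; exact: ltW.
by move/infinite_nat.
Qed.

(** Finitely generated additive monoids, to which local finiteness of the set
    of exponents is reduced; the recursion on the generators is the induction
    of [nat_span_locally_finite]. *)
Fixpoint nat_span (gs : seq R) : set R :=
  if gs is g :: gs' then [set x | exists (n : nat) s, nat_span gs' s /\ x = n%:R * g + s]
  else [set 0].

Lemma nat_span_ge0 gs s : (forall g, g \in gs -> 0 <= g) -> nat_span gs s -> 0 <= s.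
Proof.
elim: gs s => [|g gs IH] s gs0 /=; first by move=> ->.
move=> [n [s' [s's ->]]]; rewrite addr_ge0//.
  by rewrite mulr_ge0// gs0// mem_head.
by apply: IH => // h hgs; apply: gs0; rewrite inE hgs orbT.
Qed.

(** A positive generator can be used only boundedly often below [b], and a zero
    generator contributes nothing. *)
Lemma nat_span_locally_finite gs : (forall g, g \in gs -> 0 <= g) ->
  locally_finite (nat_span gs).
Proof.
elim: gs => [|g gs IH] gs0 b.
  by apply: sub_finite_set (finite_set1 0) => s [].
have gs0' h : h \in gs -> 0 <= h by move=> hgs; apply: gs0; rewrite inE hgs orbT.
have : 0 <= g by apply: gs0; exact: mem_head.
rewrite le_eqVlt => /orP[/eqP g0|g0].
  apply: sub_finite_set (IH gs0' b) => s [[n [s' [s's ->]]]] /=.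
  by rewrite -g0 mulr0 add0r.
(* [g] occurs fewer than [N] times in a sum that is at most [b] *)
pose N := (Num.truncn (b / g)).+1.
apply: (@sub_finite_set _ _ ([set x.1%:R * g + x.2 | x in
  `I_N `*` (nat_span gs `&` [set s | s <= b])])).
  move=> s [[n [s' [s's ->]]]] /= nsb; have s'0 := nat_span_ge0 gs0' s's.
  exists (n, s') => //=; split; last first.
    by split => //=; apply: le_trans nsb; rewrite lerDr mulr_ge0// ltW.
  have b0 : 0 <= b by apply: le_trans nsb; rewrite addr_ge0// mulr_ge0// ltW.
  rewrite /= /N ltnS truncn_ge_nat ?divr_ge0 ?(ltW g0)//.
  by rewrite ler_pdivlMr//; apply: le_trans nsb; rewrite lerDl.
apply: finite_image; apply: finite_setX; first exact: finite_II.
exact: IH.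
Qed.

Lemma nat_span_sum (I : Type) (r : seq I) (n : I -> nat) (g : I -> R) :
  nat_span [seq g i | i <- r] (\sum_(i <- r) (n i)%:R * g i).
Proof.
elim: r => [|i r IH] /=; first by rewrite big_nil.
by rewrite big_cons; exists (n i), (\sum_(j <- r) (n j)%:R * g j).
Qed.

Lemma nat_span_cat gs hs s t : nat_span gs s -> nat_span hs t ->
  nat_span (gs ++ hs) (s + t).
Proof.
elim: gs s => [|g gs IH] s /=; first by move=> ->; rewrite add0r.
move=> [n [s' [s's ->]]] ht; exists n, (s' + t); split; first exact: IH.
by rewrite addrA.
Qed.

End Enumeration.

Lemma fsum_iota (V : nmodType) (D : set nat) (f : nat -> V) (N : nat) :
  (forall j, D j -> (N <= j)%N -> f j = 0) ->
  \sum_(j \in D) f j = \sum_(j <- iota 0 N | j \in D) f j.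
Proof.
move=> f0; rewrite (fsbigE [seq j <- iota 0 N | j \in D]).
- by rewrite big_filter_cond; apply: eq_bigl => j; rewrite andbb.
- by rewrite filter_uniq// iota_uniq.
- by move=> j /=; rewrite mem_filter => /andP[/set_mem].
move=> j Dj; rewrite mem_filter mem_set//= mem_iota add0n -leqNgt; exact: f0.
Qed.

Section ExponentSet.
Context {R : realType} {dstar : nat} (lam : 'I_dstar -> R) (n0 : 'I_dstar).
Context (K : option nat) (beta : nat -> R).
Hypothesis lam_pos : forall k, 0 < lam k.
Hypothesis lam_incr : forall k l : 'I_dstar, (k < l)%N -> lam k < lam l.
Hypothesis alpha_pos : forall r, term_indices K r -> 0 < alpha beta r.
Local Notation S := (Stilde lam n0 K beta).

Lemma lam_gap_ge0 (k : 'I_dstar) : (n0 <= k)%N -> 0 <= lam k - lam n0.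
Proof.
rewrite leq_eqVlt => /orP[/eqP/val_inj ->|/lam_incr]; first by rewrite subrr.
by rewrite subr_ge0 => /ltW.
Qed.

(** Elements of [Stilde] as finite sums over an initial segment of the indices;
    its length may be enlarged at will ([exponent_of_Stilde]), so that two
    elements can be written over the same segment. *)
Definition exponent (m : 'I_dstar -> nat) (z : nat -> nat) (N : nat) : R :=
  \sum_(k < dstar | (n0 <= k)%N) (m k)%:R * (lam k - lam n0)
  + \sum_(j <- iota 0 N | j \in term_indices K) (z j)%:R * (alpha beta j * lam n0).

Lemma Stilde_exponent m z N : S (exponent m z N).
Proof.
exists m, (fun j => if (j < N)%N then z j else 0%N); split.
  apply: sub_finite_set (finite_II N) => j [_] /=.
  by case: ifP.
congr (_ + _); rewrite (@fsum_iota _ _ _ N); last first.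
  by move=> j _; rewrite leqNgt => /negbTE ->; rewrite !mul0r.
rewrite big_seq_cond [RHS]big_seq_cond; apply: eq_bigr => j.
by rewrite mem_iota add0n => /andP[/andP[_ ->] _]; rewrite mulrA.
Qed.

Lemma exponent_of_Stilde s : S s ->
  exists m z N, forall N', (N <= N')%N -> s = exponent m z N'.
Proof.
move=> [m [z [zf ->]]].
have [N NP] : exists N, forall j, term_indices K j -> (N <= j)%N -> z j = 0%N.
  have /finite_seqP[l lE] := zf; exists (\max_(j <- l) j).+1 => j Kj Nj.
  apply/eqP; rewrite -leqn0 leqNgt; apply/negP => zj.
  have jl : j \in l by have : [set` l] j by rewrite -lE.
  have jm : (j <= \max_(i <- l) i)%N by apply: (@leq_bigmax_seq _ l xpredT id).
  by move: Nj; rewrite ltnNge jm.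
exists m, z, N => N' NN'; congr (_ + _).
rewrite (@fsum_iota _ _ _ N'); first by apply: eq_bigr => j _; rewrite mulrA.
by move=> j Kj N'j; rewrite NP ?mul0r// (leq_trans NN').
Qed.

Lemma exponent_ge0 m z N : 0 <= exponent m z N.
Proof.
rewrite addr_ge0//.
  by apply: sumr_ge0 => k nk; rewrite mulr_ge0// lam_gap_ge0.
by apply: sumr_ge0 => j /set_mem Kj; rewrite !mulr_ge0// ltW// alpha_pos.
Qed.

Lemma Stilde_ge0 s : S s -> 0 <= s.
Proof. by move=> /exponent_of_Stilde[m [z [N /(_ N (leqnn N)) ->]]]; exact: exponent_ge0. Qed.

Lemma Stilde0 : S 0.
Proof.
have := Stilde_exponent (fun=> 0%N) (fun=> 0%N) 0; rewrite /exponent big_nil addr0.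
by rewrite big1// => k _; rewrite mul0r.
Qed.

Lemma StildeD s s' : S s -> S s' -> S (s + s').
Proof.
move=> /exponent_of_Stilde[m [z [N NP]]] /exponent_of_Stilde[m' [z' [N' NP']]].
rewrite (NP (maxn N N')) ?leq_maxl// (NP' (maxn N N')) ?leq_maxr//.
have := Stilde_exponent (fun k => m k + m' k)%N (fun j => z j + z' j)%N (maxn N N').
congr (S _); rewrite /exponent addrACA -!big_split.
by congr (_ + _); apply: eq_bigr => i _; rewrite natrD mulrDl.
Qed.

Lemma Stilde_lam (k : 'I_dstar) : (n0 <= k)%N -> S (lam k - lam n0).
Proof.
move=> nk; have := Stilde_exponent (fun l => (l == k) : nat) (fun=> 0%N) 0.
rewrite /exponent big_nil addr0 (bigD1 k)//= eqxx mul1r big1 ?addr0//.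
by move=> l /andP[_ /negbTE ->]; rewrite mul0r.
Qed.

Lemma Stilde_alpha r : term_indices K r -> S (alpha beta r * lam n0).
Proof.
move=> Kr; have := Stilde_exponent (fun=> 0%N) (fun j => (j == r) : nat) r.+1.
rewrite /exponent big1 ?add0r; last by move=> k _; rewrite mul0r.
rewrite big_mkcond (bigD1_seq r) ?iota_uniq ?mem_iota//= mem_set// eqxx mul1r.
rewrite big1 ?addr0// => j /negbTE ->; by rewrite mul0r if_same.
Qed.

Lemma Stilde_unbounded r b : term_indices K r -> exists2 s, S s & b < s.
Proof.
move=> Kr; pose g := alpha beta r * lam n0.
have g0 : 0 < g by rewrite mulr_gt0// alpha_pos.
have Sn n : S (n%:R * g).
  elim: n => [|n IH]; first by rewrite mul0r; exact: Stilde0.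
  rewrite -natr1 mulrDl mul1r; apply: StildeD => //; exact: Stilde_alpha.
exists ((Num.truncn (b / g)).+1%:R * g); first exact: Sn.
by rewrite -ltr_pdivrMr//; exact: truncnS_gt.
Qed.

(** Below [b] the generators [alpha_r lam] that exceed [b] do not occur, so
    finitely many generators remain. *)
Lemma Stilde_locally_finite :
  (forall b, exists N, forall r, term_indices K r -> (N <= r)%N ->
     b < alpha beta r * lam n0) ->
  locally_finite S.
Proof.
move=> alpha_large b; have [N NP] := alpha_large b.
pose gs := [seq (if (n0 <= k)%N then lam k - lam n0 else 0) | k : 'I_dstar] ++
  [seq (if r \in term_indices K then alpha beta r * lam n0 else 0) | r <- iota 0 N].
have gs0 g : g \in gs -> 0 <= g.
  rewrite mem_cat => /orP[] /mapP[k _ ->].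
    by case: ifPn => // nk; exact: lam_gap_ge0.
  by case: ifPn => // /set_mem Kk; rewrite mulr_ge0 ?ltW// alpha_pos.
apply: sub_finite_set (nat_span_locally_finite gs0 b) => s [Ss /= sb]; split=> //.
have [m [z [N' N'P]]] := exponent_of_Stilde Ss.
have := N'P (maxn N N') (leq_maxr _ _); rewrite /exponent -(subnKC (leq_maxl N N')).
rewrite iotaD big_cat/= [X in _ + (_ + X)]big1_seq ?addr0; last first.
  move=> j /andP[Kj]; rewrite mem_iota add0n => /andP[Nj jN'].
  have [->|z0] := eqVneq (z j) 0%N; first by rewrite mul0r.
  have /set_mem /NP /(_ Nj) bj := Kj; exfalso.
  move: sb; rewrite leNgt => /negP; apply; apply: (lt_le_trans bj).
  rewrite (N'P (maxn N N') (leq_maxr _ _)) /exponent.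
  rewrite [X in _ + X]big_mkcond (bigD1_seq j) ?iota_uniq//=; last first.
    by rewrite mem_iota -(subnKC (leq_maxl N N')).
  rewrite Kj.
  apply: (@le_trans _ _ ((z j)%:R * (alpha beta j * lam n0))).
    by rewrite ler_peMl ?ler1n ?lt0n// mulr_ge0 ?ltW// alpha_pos//; exact: set_mem.
  rewrite addrCA lerDl addr_ge0//.
    by apply: sumr_ge0 => k nk; rewrite mulr_ge0// lam_gap_ge0.
  apply: sumr_ge0 => i _; case: ifPn => // /set_mem Ki.
  by rewrite !mulr_ge0// ltW// alpha_pos.
move=> ->; apply: nat_span_cat.
  rewrite big_mkcond/= -[X in nat_span _ X]big_enum/=.
  have := nat_span_sum (enum 'I_dstar) m
    (fun k => if (n0 <= k)%N then lam k - lam n0 else 0).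
  congr (nat_span _ _); apply: eq_bigr => k _.
  by case: ifP; rewrite ?mulr0.
rewrite big_mkcond/=; have := nat_span_sum (iota 0 N) z
  (fun r => if r \in term_indices K then alpha beta r * lam n0 else 0).
congr (nat_span _ _); apply: eq_bigr => k _.
by case: ifP; rewrite ?mulr0.
Qed.

End ExponentSet.

(** * The nonlinearity near the origin *)

Section NearZero.
Context {R : realType} {d : nat}.
Local Notation V := 'cV[R]_d.
Implicit Types (f G : V -> V) (b : R).

Lemma norm_le_enorm (x : V) : `|x| <= enorm x.
Proof.
apply: norm_le_coord => [|i j]; first exact: sqrtr_ge0.
rewrite (ord1 j) -sqrtr_sqr ler_sqrt; last by apply: sumr_ge0 => k _; exact: sqr_ge0.
by rewrite (bigD1 i)//= lerDl; apply: sumr_ge0 => k _; exact: sqr_ge0.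
Qed.

Lemma enorm_le_norm (x : V) : enorm x <= d%:R * `|x|.
Proof.
have dx : 0 <= d%:R * `|x| by rewrite mulr_ge0.
rewrite -[leRHS]ger0_norm// -sqrtr_sqr ler_sqrt ?sqr_ge0//.
apply: (@le_trans _ _ (\sum_(i < d) `|x| ^+ 2)).
  apply: ler_sum => i _; rewrite -[leLHS]ger0_norm ?sqr_ge0// normrX.
  by rewrite lerXn2r ?nnegrE//; exact: coord_le_norm.
rewrite sumr_const card_ord -[leLHS]mulr_natl exprMn ler_wpM2r ?sqr_ge0//.
by case: d => [|n]; rewrite ?expr0n ?mulr0n// expr2 ler_peMr// ler1n.
Qed.

Lemma bigO_at0_norm f b : 0 < b -> bigO_at0 f (fun x => enorm x `^ b) ->
  exists r C, [/\ 0 < r, 0 < C & forall x, `|x| < r -> `|f x| <= C * `|x| `^ b].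
Proof.
move=> b0 [r [C [r0 C0 fC]]].
have d1 : (0 : R) < d%:R + 1 by rewrite ltr_wpDl.
exists (r / (d%:R + 1)), (C * (d%:R + 1) `^ b); split.
- by rewrite divr_gt0.
- by rewrite mulr_gt0// powR_gt0.
move=> x; rewrite ltr_pdivlMr// mulrC => xr.
have ex : enorm x <= (d%:R + 1) * `|x|.
  by apply: le_trans (enorm_le_norm x) _; rewrite ler_wpM2r// lerDl.
apply: (le_trans (norm_le_enorm _)); apply: (le_trans (fC _ (le_lt_trans ex xr))).
rewrite -mulrA ler_pM2l// -powRM ?(ltW d1)//.
apply: (ge0_ler_powR (ltW b0)) => //; rewrite nnegrE; first exact: sqrtr_ge0.
by rewrite mulr_ge0// ltW.
Qed.

Lemma pos_homogeneous0 b G : 0 < b -> pos_homogeneous b G -> G 0 = 0.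
Proof.
move=> b0 /(_ 0 2 (ltr0n _ _)); rewrite scaler0 => e.
have : (2 `^ b - 1) *: G 0 = 0 by rewrite scalerBl scale1r -e subrr.
move=> /eqP; rewrite scaler_eq0 => /orP[|/eqP//].
by rewrite subr_eq0 gt_eqF// -[X in X < _](congr1 (@^~ b) (powR1 R)) gt0_ltr_powR ?nnegrE// ltr1n.
Qed.

(** The maximum on the compact unit sphere, scaled by homogeneity. The sphere
    is taken among row vectors, transposition being an isometry. *)
Lemma pos_homogeneous_bound b G : 0 < b -> pos_homogeneous b G ->
  smooth_on (~` [set 0]) G ->
  exists2 C, 0 < C & forall x, `|G x| <= C * `|x| `^ b.
Proof.
move=> b0 Gb Gs.
have normT (v : 'rV[R]_d) : `|v^T| = `|v|.
  apply/eqP; rewrite eq_le; apply/andP; split; apply: norm_le_coord => // i j.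
    by rewrite mxE; exact: coord_le_norm.
  by have := coord_le_norm v^T j i; rewrite mxE.
have contT : continuous (fun v : 'rV[R]_d => v^T).
  move=> v; apply/(@cvgrPdist_lt _ _ _ (nbhs v) (nbhs_filter v)) => e e0.
  apply/nbhs_ballP; exists e => //= w.
  by rewrite -ball_normE /= -linearB/= normT.
pose A := [set v : 'rV[R]_d | `|v| = 1].
have [x0|/forallNP x0] := pselect (exists x : V, x != 0); last first.
  exists 1 => // x; have /negP := x0 x; rewrite negbK => /eqP ->.
  by rewrite (pos_homogeneous0 b0 Gb) !normr0 powR0 ?gt_eqF// mulr0.
have [x xn0] := x0.
have A0 : A !=set0.
  exists (`|x|^-1 *: x^T); rewrite /A/= normrZ normfV normr_id -normT trmxK.
  by rewrite mulVf// normr_eq0.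
have Ac : compact A.
  apply: bounded_closed_compact.
    by exists 1; split=> // M M1 v /= ->; exact: ltW.
  have -> : A = Num.norm @^-1` [set 1] by [].
  apply: preimage_closed; last exact: closed_eq.
  by move=> v _; exact: norm_continuous.
have Af : {within A, continuous (fun v : 'rV[R]_d => `|G v^T|)}.
  apply: continuous_in_subspaceT => v /set_mem Av.
  have vn0 : v^T != 0 by rewrite -normr_eq0 normT Av oner_eq0.
  apply: continuous_comp; last exact: norm_continuous.
  apply: continuous_comp; first exact: contT.
  by apply: differentiable_continuous; apply: (Gs [::]); exact/eqP.
have [v Av vP] := EVT_max_rV A0 Ac Af.
exists (`|G v^T| + 1); first exact: ltr_wpDl.
move=> z; have [->|z0] := eqVneq z 0.
  by rewrite (pos_homogeneous0 b0 Gb) !normr0 powR0 ?gt_eqF// mulr0.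
have nz : 0 < `|z| by rewrite normr_gt0.
rewrite -[in leLHS](scale1r z) -(divff (lt0r_neq0 nz)) -scalerA (Gb _ _ nz).
rewrite normrZ ger0_norm ?powR_ge0// mulrC ler_wpM2r ?powR_ge0//.
have := vP (`|z|^-1 *: z)^T; rewrite trmxK => h.
apply: le_trans (h _) _; last by rewrite lerDl.
apply/mem_set; rewrite /A/= -normT trmxK normrZ normfV normr_id mulVf//.
exact: lt0r_neq0.
Unshelve. all: by end_near. Qed.

Definition superlinear f := exists b r C, [/\ 1 < b, 0 < r, 0 < C &
  forall x, `|x| < r -> `|f x| <= C * `|x| `^ b].

Lemma ler_powR_small (x : V) b c : 0 < c -> c <= b -> `|x| < 1 -> `|x| `^ b <= `|x| `^ c.
Proof.
move=> c0 cb x1; have [->|x0] := eqVneq x 0.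
  by rewrite normr0 !powR0// gt_eqF// (lt_le_trans c0).
by apply: ger_powR => //; rewrite normr_gt0 x0 ltW.
Qed.

Lemma superlinearD f g : superlinear f -> superlinear g ->
  superlinear (fun x => f x + g x).
Proof.
move=> [b [r [C [b1 r0 C0 fC]]]] [b' [r' [C' [b'1 r'0 C'0 gC]]]].
have m0 : 0 < Num.min b b' by rewrite lt_min !(lt_trans ltr01).
exists (Num.min b b'), (Num.min (Num.min r r') 1), (C + C'); split.
- by rewrite lt_min b1.
- by rewrite !lt_min r0 r'0 ltr01.
- exact: addr_gt0.
move=> x; rewrite !lt_min => /andP[/andP[xr xr'] x1].
rewrite mulrDl (le_trans (ler_normD _ _))// lerD//.
  apply: le_trans (fC _ xr) _; rewrite ler_pM2l// ler_powR_small// ge_min lexx//.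
apply: le_trans (gC _ xr') _; rewrite ler_pM2l// ler_powR_small// ge_min lexx orbT//.
Qed.

(** A common form of the two hypotheses: the number of terms depends on the
    required order [B] for an infinite expansion, and is fixed for a finite
    one, whose remainder is of every order. *)
Lemma expansion_cut (F : V -> V) K (beta : nat -> R) Fr (B : R) :
  0 <= B -> expansion F K beta Fr ->
  exists r0 b, [/\ B < b, forall r, (r < r0)%N -> term_indices K r,
    forall r, term_indices K r -> (r0 <= r)%N -> B < beta r &
    exists rho C, [/\ 0 < rho, 0 < C & forall x, `|x| < rho ->
      `|F x - \sum_(k < r0) Fr k x| <= C * `|x| `^ b]].
Proof.
move=> B0; case: K => [Nstar|] /=.
  move=> [N0 _ _ _ /(_ (Num.max B (beta Nstar.-1) + 1))].
  have bB : B < Num.max B (beta Nstar.-1) + 1.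
    by rewrite (@le_lt_trans _ _ (Num.max B (beta Nstar.-1)))// ?ltrDl// le_max lexx.
  move=> []; first by rewrite (@le_lt_trans _ _ (Num.max B (beta Nstar.-1)))//
    ?ltrDl// le_max lexx orbT.
  move=> r fO; exists Nstar, (Num.max B (beta Nstar.-1) + 1); split => //.
    by move=> k; rewrite ltnNge => /negP kN /kN.
  apply: bigO_at0_norm; first exact: le_lt_trans bB.
  by exists r.
move=> [b1 bincr binf _ Fexp].
have [N _ NP] : \forall n \near \oo, B < beta n.
  by have /cvgryPgt := binf; apply.
have [b bb fO] := Fexp N; exists N.+1, b.
have Bb : B < b by rewrite (lt_trans _ bb)// NP /=.
split => //; first by move=> r _ Nr; apply: NP => /=; exact: ltnW.
by apply: bigO_at0_norm fO; exact: le_lt_trans Bb.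
Qed.

Lemma expansion_beta_gt1 (F : V -> V) K (beta : nat -> R) Fr r :
  expansion F K beta Fr -> term_indices K r -> 1 < beta r.
Proof.
case: K => [Nstar|] /=; first by move=> [_ + _ _ _] rN; apply.
by move=> [+ _ _ _ _] _; apply.
Qed.

Lemma expansion_term (F : V -> V) K (beta : nat -> R) Fr r :
  expansion F K beta Fr -> term_indices K r ->
  pos_homogeneous (beta r) (Fr r) /\ smooth_on (~` [set 0]) (Fr r).
Proof.
case: K => [Nstar|] /=; first by move=> [_ _ _ + _] rN; apply.
by move=> [_ _ _ + _] _; apply.
Qed.

(** All exponents [beta_r] exceed 1, and so does the order of the remainder. *)
Lemma expansion_superlinear (F : V -> V) K (beta : nat -> R) Fr :
  expansion F K beta Fr -> superlinear F.
Proof.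
move=> Fexp; have [r0 [b [b1 r0K _ [rho [C [rho0 C0 FC]]]]]] := expansion_cut ler01 Fexp.
have -> : F = (fun x => (F x - \sum_(k < r0) Fr k x) + \sum_(k < r0) Fr k x).
  by apply/funext => x; rewrite subrK.
apply: superlinearD; first by exists b, rho, C.
elim: r0 r0K {FC} => [_|r0 IH r0K].
  exists 2, 1, 1; split => //; first by rewrite ltr1n.
  by move=> x _; rewrite big_ord0 normr0 mul1r powR_ge0.
have -> : (fun x => \sum_(k < r0.+1) Fr k x) =
    (fun x => \sum_(k < r0) Fr k x + Fr r0 x).
  by apply/funext => x; rewrite big_ord_recr.
apply: superlinearD; first by apply: IH => k kr; apply: r0K; exact: ltnW.
have Kr := r0K r0 (ltnSn _); have b1' := expansion_beta_gt1 Fexp Kr.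
have [Gb Gs] := expansion_term Fexp Kr.
have [D D0 DP] := pos_homogeneous_bound (lt_trans ltr01 b1') Gb Gs.
by exists (beta r0), 1, D; split.
Qed.

End NearZero.

(** * Superlinear maps along decaying curves *)

Section SuperlinearTools.
Context {R : realType} {d : nat}.
Local Notation V := 'cV[R]_d.
Implicit Types (f : V -> V) (z : R -> V).

Lemma expdecay_to0 z a : 0 < a -> expdecay z a ->
  forall r, 0 < r -> \forall t \near +oo, `|z t| < r.
Proof.
move=> a0 [C C0 zC] r r0; near=> t.
apply: (@le_lt_trans _ _ (C * expR (- a * t))); first by near: t.
rewrite mulNr expRN ltr_pdivrMr ?expR_gt0//.
have : C / (r * a) < t by near: t; apply: nbhs_pinfty_gt; exact: num_real.
rewrite ltr_pdivrMr ?mulr_gt0// => Ct; apply: (lt_le_trans Ct).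
rewrite mulrCA ler_pM2l// mulrC (le_trans _ (expR_ge1Dx _))// lerDr.
by [].
Unshelve. all: by end_near. Qed.

Lemma expdecay_powR z f a b r C : 0 < a -> 0 < b -> 0 < r -> 0 < C ->
  (forall x, `|x| < r -> `|f x| <= C * `|x| `^ b) ->
  expdecay z a -> expdecay (f \o z) (a * b).
Proof.
move=> a0 b0 r0 C0 fC zd; have zr := expdecay_to0 a0 zd r0.
have [D D0 zD] := zd; exists (C * D `^ b); first by rewrite mulr_gt0// powR_gt0.
near=> t; apply: (@le_trans _ _ (C * `|z t| `^ b)).
  by apply: fC; near: t.
rewrite -mulrA ler_pM2l//.
have -> : - (a * b) * t = (- a * t) * b by ring.
rewrite expRM -powRM ?expR_ge0 ?(ltW D0)//.
apply: (ge0_ler_powR (ltW b0)); rewrite ?nnegrE ?mulr_ge0 ?expR_ge0 ?(ltW D0)//.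
by near: t.
Unshelve. all: by end_near. Qed.

(** [C |x|^b = C |x|^(b-1) |x|], whose first factor is small with [x]. *)
Lemma superlinear_small f : superlinear f -> forall e, 0 < e ->
  exists2 r, 0 < r & forall x, `|x| < r -> `|f x| <= e * `|x|.
Proof.
move=> [b [r [C [b1 r0 C0 fC]]]] e e0.
have b10 : 0 < b - 1 by rewrite subr_gt0.
have eC : 0 < e / C by rewrite divr_gt0.
exists (Num.min r ((e / C) `^ (b - 1)^-1)); first by rewrite lt_min r0 powR_gt0.
move=> x; rewrite lt_min => /andP[xr xe]; apply: (le_trans (fC _ xr)).
rewrite -mulr_powRB1// ?(lt_trans ltr01)// mulrCA mulrC ler_wpM2r//.
rewrite mulrC -ler_pdivlMr//.
have -> : e / C = ((e / C) `^ (b - 1)^-1) `^ (b - 1).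
  by rewrite -powRrM mulVf ?powRr1 ?ltW// gt_eqF.
apply: (ge0_ler_powR (ltW b10)); rewrite ?nnegrE ?powR_ge0//.
exact: ltW.
Qed.

Lemma mulmx_norm_bound (P : 'M[R]_d) : exists2 c : R, 0 < c &
  forall x : V, `|P *m x| <= c * `|x|.
Proof.
have c0 : 0 <= \sum_ij `|P ij.1 ij.2| by apply: sumr_ge0.
exists (1 + \sum_ij `|P ij.1 ij.2|); first by rewrite ltr_pwDl.
move=> x; apply: norm_le_coord => [|i j]; first by rewrite mulr_ge0// addr_ge0.
rewrite mxE (le_trans (ler_norm_sum _ _ _))//.
apply: (@le_trans _ _ (\sum_k `|P i k| * `|x|)).
  by apply: ler_sum => k _; rewrite normrM ler_wpM2l// coord_le_norm.
rewrite -mulr_suml ler_wpM2r//.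
rewrite -(pair_bigA _ (fun i j => `|P i j|))/= [X in 1 + X](bigD1 i)//=.
rewrite addrCA lerDl addr_ge0//.
by apply: sumr_ge0 => k _; exact: sumr_ge0.
Qed.

Lemma superlinear_mulmx (P Q : 'M[R]_d) f : superlinear f ->
  superlinear (fun x => P *m f (Q *m x)).
Proof.
move=> [b [r [C [b1 r0 C0 fC]]]].
have [p p0 pP] := mulmx_norm_bound P; have [q q0 qQ] := mulmx_norm_bound Q.
exists b, (r / q), (p * C * q `^ b); split => //.
- by rewrite divr_gt0.
- by rewrite !mulr_gt0// powR_gt0.
have b0 : 0 < b := lt_trans ltr01 b1.
move=> x; rewrite ltr_pdivlMr// mulrC => xr; apply: (le_trans (pP _)).
rewrite -!mulrA ler_pM2l//; apply: (le_trans (fC _ (le_lt_trans (qQ x) xr))).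
rewrite ler_pM2l// -powRM ?(ltW q0)//.
by apply: (ge0_ler_powR (ltW b0)); rewrite ?nnegrE ?mulr_ge0 ?(ltW q0).
Qed.

End SuperlinearTools.

(** * The leading exponential term *)

Section DiagonalFlow.
Context {R : realType} {d : nat}.
Local Notation V := 'cV[R]_d.
Context (D : 'I_d -> R) (f : V -> V) (z : R -> V).
Hypothesis D_pos : forall i, 0 < D i.
Hypothesis f_superlinear : superlinear f.
Hypothesis z_ode : forall t : R, 0 < t -> forall i,
  is_derive t (1 : R) (fun s => z s i 0) (- D i * z t i 0 + f (z t) i 0).
Hypothesis z_lim : forall r : R, 0 < r -> \forall t \near +oo, `|z t| < r.
Hypothesis z0_neq0 : z 0 != 0.
Hypothesis z_right0 : forall e : R, 0 < e -> exists2 r : R, 0 < r &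
  forall t, 0 <= t < r -> `|z t - z 0| < e.

Definition energy (t : R) : R := \sum_i z t i 0 * z t i 0.
Definition energy_rate (t : R) : R := \sum_i z t i 0 * (- D i * z t i 0 + f (z t) i 0) *+ 2.

Lemma energy_ge0 t : 0 <= energy t.
Proof. by apply: sumr_ge0 => i _; rewrite -expr2 sqr_ge0. Qed.

Lemma norm_sqr_le_energy t : `|z t| ^+ 2 <= energy t.
Proof.
have E0 := energy_ge0 t.
rewrite -(sqr_sqrtr E0) lerXn2r ?nnegrE ?sqrtr_ge0//.
apply: norm_le_coord => [|i j]; first exact: sqrtr_ge0.
rewrite (ord1 j) -sqrtr_sqr ler_sqrt// expr2 /energy (bigD1 i)//= lerDl.
by apply: sumr_ge0 => k _; rewrite -expr2 sqr_ge0.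
Qed.

Lemma energy_gt0 t : z t != 0 -> 0 < energy t.
Proof.
move=> zt; apply: lt_le_trans (norm_sqr_le_energy t).
by rewrite exprn_gt0// normr_gt0.
Qed.

Lemma is_derive_energy (t : R) : 0 < t -> is_derive t (1 : R) energy (energy_rate t).
Proof.
move=> t0; have -> : energy = \sum_(i < d) (fun s => z s i 0 * z s i 0).
  by apply/funext => s; rewrite fct_sumE.
have h (i : 'I_d) := @is_deriveM _ _ _ _ _ _ _ _ (z_ode t0 i) (z_ode t0 i).
have := @is_derive_sum _ _ _ d _ t 1 _ h.
by move/is_derive_eq; apply; apply: eq_bigr => i _; rewrite /GRing.scale/= mulr2n.
Qed.

Lemma forcing_energy_bound (e t : R) : 0 <= e -> `|f (z t)| <= e * `|z t| ->
  `|\sum_i z t i 0 * f (z t) i 0| <= d%:R * e * energy t.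
Proof.
move=> e0 fe; apply: (le_trans (ler_norm_sum _ _ _)).
apply: (@le_trans _ _ (\sum_(i < d) e * energy t)); last first.
  by rewrite sumr_const card_ord -mulrA [leRHS]mulr_natl.
apply: ler_sum => i _; rewrite normrM.
apply: (@le_trans _ _ (`|z t| * (e * `|z t|))).
  by rewrite ler_pM// ?coord_le_norm// (le_trans (coord_le_norm _ _ _)).
by rewrite mulrCA -expr2 ler_wpM2l// norm_sqr_le_energy.
Qed.

Lemma energy_rateE t : energy_rate t =
  (- (\sum_i D i * (z t i 0 * z t i 0)) + \sum_i z t i 0 * f (z t) i 0) *+ 2.
Proof.
rewrite -sumrN -big_split/= -sumrMnl; apply: eq_bigr => i _; congr (_ *+ 2).
by rewrite mulrDr; congr (_ + _); ring.
Qed.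

Lemma energy_rate_le (lam e t : R) : 0 <= e -> (forall i, lam <= D i) ->
  `|f (z t)| <= e * `|z t| ->
  energy_rate t <= - (lam - d%:R * e) * energy t *+ 2.
Proof.
move=> e0 lamD fe; rewrite energy_rateE lerMn2r/=.
have /andP[_ h] : - (d%:R * e * energy t) <= \sum_i z t i 0 * f (z t) i 0
    <= d%:R * e * energy t by rewrite -ler_norml; exact: forcing_energy_bound.
have : lam * energy t <= \sum_i D i * (z t i 0 * z t i 0).
  by rewrite mulr_sumr; apply: ler_sum => i _; rewrite ler_wpM2r// -expr2 sqr_ge0.
lra.
Qed.

Lemma energy_rate_ge (lam e t : R) : 0 <= e -> (forall i, D i <= lam) ->
  `|f (z t)| <= e * `|z t| ->
  - (lam + d%:R * e) * energy t *+ 2 <= energy_rate t.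
Proof.
move=> e0 lamD fe; rewrite energy_rateE lerMn2r/=.
have /andP[h _] : - (d%:R * e * energy t) <= \sum_i z t i 0 * f (z t) i 0
    <= d%:R * e * energy t by rewrite -ler_norml; exact: forcing_energy_bound.
have : \sum_i D i * (z t i 0 * z t i 0) <= lam * energy t.
  by rewrite mulr_sumr; apply: ler_sum => i _; rewrite ler_wpM2r// -expr2 sqr_ge0.
lra.
Qed.

Let Dsum := \sum_i D i.
Lemma D_le_sum i : D i <= Dsum.
Proof.
by rewrite /Dsum (bigD1 i)//= lerDl; apply: sumr_ge0 => j _; exact: ltW.
Qed.

(** The linear part changes the energy at a rate at most twice the sum of the
    [D i], and the nonlinearity, bounded by [|x|] near 0, at a rate at most [2
    d]; so the energy times a growing exponential is nondecreasing. *)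
Lemma energy_lower (r s t : R) : 0 < s -> s <= t ->
  (forall x, `|x| < r -> `|f x| <= 1 * `|x|) ->
  (forall u, s <= u <= t -> `|z u| < r) ->
  energy s * expR (- ((Dsum + d%:R) *+ 2) * (t - s)) <= energy t.
Proof.
move=> s0 st fr zr; set c := (Dsum + d%:R) *+ 2.
have : - (energy t * expR (c * t)) <= - (energy s * expR (c * s)).
  apply: (@nincr_of_derive R (fun t => - (energy t * expR (c * t)))
    (fun t => - (energy_rate t * expR (c * t) + energy t * (c * expR (c * t))))) => // u ust.
    have u0 : 0 < u by case/andP: ust => su _; exact: lt_le_trans su.
    have := @is_deriveN _ _ _ _ _ _ _ (@is_deriveM _ _ _ _ _ _ _ _
      (is_derive_energy u0) (is_derive_expRM c u)).
    by move/is_derive_eq; apply; rewrite /GRing.scale/=; ring.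
  rewrite oppr_le0 mulrA -mulrDl mulr_ge0 ?expR_ge0//.
  have := energy_rate_ge ler01 D_le_sum (fr _ (zr _ ust)).
  by rewrite /c mulr1; lra.
rewrite lerN2 => h; rewrite -(ler_pM2r (expR_gt0 (c * t))) -mulrA -expRD.
by have -> : - c * (t - s) + c * t = c * s by ring.
Qed.

Lemma solution_continuous (s : R) : 0 < s -> forall e : R, 0 < e -> exists2 r : R, 0 < r &
  forall t, `|t - s| < r -> `|z t - z s| < e.
Proof.
move=> s0 e e0.
have dz : derivable z s 1.
  by apply/derivable_mxP => i j; rewrite (ord1 j); case: (z_ode s0 i).
have /derivable1_diffP/differentiable_continuous/cvgrPdist_lt/(_ e e0) := dz.
move=> /nbhs_ballP[r /= r0 rP]; exists r => // t ts; rewrite distrC; apply: rP.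
by rewrite -ball_normE /= distrC.
Qed.

(** At the first zero [s] the energy would vanish, although just before it is
    positive and cannot decay faster than exponentially by [energy_lower]. The
    zero is not at the origin, by right continuity there. *)
Lemma solution_neq0 (t : R) : 0 <= t -> z t != 0.
Proof.
move=> t0; apply/negP => /eqP zt0.
pose S := [set s | 0 <= s /\ z s = 0]; pose s := inf S.
have [r r0 zr] : exists2 r, 0 < r & forall u, 0 <= u < r -> z u != 0.
  have [|r r0 rP] := z_right0 (e := `|z 0|); first by rewrite normr_gt0.
  by exists r => // u /rP; apply: contraTneq => ->; rewrite sub0r normrN ltxx.
have Sinf : has_inf S.
  by split; [exists t; split|exists 0 => u [? _]].
have rs : r <= s.
  apply: lb_le_inf; first by exists t; split.
  move=> u [u0 zu]; rewrite leNgt; apply/negP => ur.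
  by have := zr u; rewrite u0 ur zu eqxx => /(_ isT).
have s0 := lt_le_trans r0 rs.
have before u : 0 <= u < s -> z u != 0.
  move=> /andP[u0 us]; apply/eqP => zu; move: us; rewrite ltNge => /negP; apply.
  by apply: ge_inf; [case: Sinf|split].
have zs : z s = 0.
  apply/eqP/negPn/negP => zs.
  have [|q q0 qP] := solution_continuous s0 (e := `|z s|); first by rewrite normr_gt0.
  have [u [u0 zu] us] := inf_adherent q0 Sinf.
  have su : s <= u by apply: ge_inf; [case: Sinf|split].
  have := qP u; rewrite zu sub0r normrN ltxx ger0_norm ?subr_ge0// ltrBlDl.
  by move=> /(_ us).
have [q q0 qP] := superlinear_small f_superlinear ltr01.
have [w w0 wP] := solution_continuous s0 q0.
(* a time before [s], positive and close enough to [s] for the solution to be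
   small from then on *)
pose u := s - Num.min (w / 2) (s / 2).
have m0 : 0 < Num.min (w / 2) (s / 2) by rewrite lt_min !divr_gt0.
have mw : Num.min (w / 2) (s / 2) <= w / 2 by rewrite ge_min lexx.
have ms : Num.min (w / 2) (s / 2) <= s / 2 by rewrite ge_min lexx orbT.
have u0 : 0 < u by rewrite /u; lra.
have us : u < s by rewrite /u; lra.
have := energy_lower u0 (ltW us) qP; move=> h.
have : energy u * expR (- ((Dsum + d%:R) *+ 2) * (s - u)) <= energy s.
  apply: h => v /andP[uv vs]; have := wP v; rewrite zs subr0; apply.
  by rewrite ler0_norm ?subr_le0//; move: uv; rewrite /u; lra.
have -> : energy s = 0.
  by rewrite /energy zs big1// => i _; rewrite !mxE mulr0.
rewrite leNgt => /negP; apply; rewrite mulr_gt0 ?expR_gt0// energy_gt0// before//.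
by rewrite (ltW u0).
Qed.

Lemma energy_not_superexponential : exists c k, 0 < k /\
  \forall t \near +oo, k * expR (- c * t) <= energy t.
Proof.
have [q q0 qP] := superlinear_small f_superlinear ltr01.
have [M [_ MP]] := z_lim q0.
pose s := Num.max M 0 + 1.
have Ms : M < s by rewrite (@le_lt_trans _ _ (Num.max M 0)) ?ltrDl// le_max lexx.
have s0 : 0 < s by rewrite (@le_lt_trans _ _ (Num.max M 0)) ?ltrDl// le_max lexx orbT.
set c := (Dsum + d%:R) *+ 2.
exists c, (energy s * expR (c * s)); split.
  by rewrite mulr_gt0 ?expR_gt0// energy_gt0// solution_neq0// ltW.
near=> t; have st : s <= t by near: t; apply: nbhs_pinfty_ge; exact: num_real.
have := energy_lower s0 st qP; rewrite -/c -mulrA -expRD.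
have -> : c * s + - c * t = - c * (t - s) by ring.
by apply => u /andP[su _]; apply: MP; exact: lt_le_trans su.
Unshelve. all: by end_near. Qed.

(** Near 0 the nonlinear part of the rate of the energy is at most half of the
    linear one. *)
Lemma solution_expdecay : exists2 a, 0 < a & expdecay z a.
Proof.
have [lam lam0 lamD] : exists2 lam, 0 < lam & forall i, lam <= D i.
  exists (\big[Num.min/1]_i D i) => [|i]; last exact: bigmin_le.
  by elim/big_ind: _ => // x y x0 y0; rewrite lt_min x0.
(* makes the nonlinear contribution [d e] at most [lam / 2] *)
pose e := lam / (2 * (d%:R + 1)).
have d1 : (0 : R) < d%:R + 1 by rewrite ltr_wpDl.
have e0 : 0 < e by rewrite divr_gt0// mulr_gt0.
have de : d%:R * e <= lam / 2.
  have <- : (d%:R + 1) * e = lam / 2 by rewrite /e; field; rewrite gt_eqF.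
  by rewrite ler_wpM2r ?(ltW e0)// lerDl.
have [q q0 qP] := superlinear_small f_superlinear e0.
have [M [_ MP]] := z_lim q0.
pose s := Num.max M 0 + 1.
have Ms : M < s by rewrite (@le_lt_trans _ _ (Num.max M 0)) ?ltrDl// le_max lexx.
have s0 : 0 < s by rewrite (@le_lt_trans _ _ (Num.max M 0)) ?ltrDl// le_max lexx orbT.
have E (t : R) : s <= t -> energy t * expR (lam * t) <= energy s * expR (lam * s).
  move=> st; apply: (@nincr_of_derive R (fun t => (energy t * expR (lam * t)))
    (fun t => (energy_rate t * expR (lam * t) + energy t * (lam * expR (lam * t))))) => //
    u /andP[su _].
    have u0 : 0 < u by exact: lt_le_trans su.
    have := (@is_deriveM _ _ _ _ _ _ _ _
      (is_derive_energy u0) (is_derive_expRM lam u)).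
    by move/is_derive_eq; apply; rewrite /GRing.scale/=; ring.
  rewrite mulrA -mulrDl mulr_le0_ge0 ?expR_ge0//.
  have := energy_rate_le (ltW e0) lamD (qP _ (MP _ (lt_le_trans Ms su))).
  have : d%:R * e * energy u <= lam / 2 * energy u by rewrite ler_wpM2r ?energy_ge0.
  lra.
exists (lam / 2); first by rewrite divr_gt0.
pose C := Num.sqrt (energy s * expR (lam * s)).
exists (C + 1); first by rewrite ltr_wpDl// sqrtr_ge0.
near=> t; have st : s <= t by near: t; apply: nbhs_pinfty_ge; exact: num_real.
apply: (@le_trans _ _ (C * expR (- (lam / 2) * t))); last first.
  by rewrite ler_wpM2r ?expR_ge0// lerDl.
rewrite -[leLHS]ger0_norm// -sqrtr_sqr -[X in C * X]ger0_norm ?expR_ge0//.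
rewrite -sqrtr_sqr -sqrtrM; last by rewrite mulr_ge0 ?energy_ge0 ?expR_ge0.
rewrite ler_sqrt; last by rewrite !mulr_ge0 ?energy_ge0 ?expR_ge0 ?sqr_ge0.
apply: (le_trans (norm_sqr_le_energy t)).
rewrite expr2 -expRD.
have -> : - (lam / 2) * t + - (lam / 2) * t = - (lam * t) by field.
by rewrite expRN ler_pdivlMr ?expR_gt0// E.
Unshelve. all: by end_near. Qed.

Definition has_leading_term := exists (i0 : 'I_d) (xi : V), [/\ xi != 0,
  forall i, xi i 0 != 0 -> D i = D i0 &
  sdecay (fun t => z t - expR (- D i0 * t) *: xi) (D i0)].

(** The midpoint between [y] and the largest [D i] below it (or [x]):
    [linear_ode_decay] requires a rate distinct from all [D i]. *)
Lemma generic_rate (x y : R) : x < y -> exists c, [/\ x < c, c < y &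
  forall i, c != D i].
Proof.
move=> xy; pose m := \big[Num.max/x]_(i | D i < y) D i.
have my : m < y.
  by rewrite /m; elim/big_ind: _ => // a b ay b_y; rewrite gt_max ay.
have xm : x <= m by exact: bigmax_ge_id.
exists ((m + y) / 2); have [h1 h2] := midf_lt my; split => //.
  exact: le_lt_trans h1.
move=> i; have [Diy|yDi] := ltP (D i) y; last by rewrite lt_eqF// (lt_le_trans h2).
by rewrite gt_eqF// (le_lt_trans _ h1)//; exact: le_bigmax_cond.
Qed.

(** If [z = O(e^(-at))] then the forcing is [O(e^(-a b0 t))], so by
    [linear_ode_decay] every component is [c_i e^(-D_i t)] up to a rate close
    to [a b0]. If some [c_i] with [D_i] below that rate is nonzero, the
    smallest such [D_i] gives the leading term; otherwise [z] itself decays at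
    the better rate. *)
Lemma decay_bootstrap : exists2 al, 0 < al & forall a, 0 < a -> expdecay z a ->
  has_leading_term \/ exists2 b, a * (1 + al) < b & expdecay z b.
Proof.
have [b0 [r [C [b01 r0 C0 fC]]]] := f_superlinear.
exists ((b0 - 1) / 2); first by rewrite divr_gt0// subr_gt0.
move=> a a0 za.
have fz : expdecay (f \o z) (a * b0).
  exact: expdecay_powR (lt_trans ltr01 b01) r0 C0 fC za.
have [|b [ab bb0 bD]] := @generic_rate (a * (1 + (b0 - 1) / 2)) (a * b0).
  by rewrite ltr_pM2l//; lra.
have /choice [c cP] : forall i, exists c,
    expdecay (fun t => z t i 0 - c * expR (- D i * t)) b.
  move=> i; apply: (@linear_ode_decay _ _ _ _ (fun t => f (z t) i 0)) => //.
    near=> t; apply: z_ode; near: t; exact: nbhs_pinfty_gt.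
  apply: expdecay_weaken (ltW bb0) _.
  by move/expdecay_coord: fz; apply.
have bpos : 0 < b.
  by apply: lt_trans ab; rewrite mulr_gt0//; lra.
have zi i : c i = 0 \/ b <= D i -> expdecay (fun t => z t i 0) b.
  move=> ciD; apply: (@eq_expdecay _ _ _ (fun t => (z t i 0 -
    c i * expR (- D i * t)) + c i * expR (- D i * t))).
    by near=> t; rewrite subrK.
  apply: expdecayD => //; case: ciD => [->|bDi].
    by apply: eq_expdecay (expdecay0 R _); near=> t; rewrite mul0r.
  exact: expdecay_weaken bDi (expdecayZl (c i) (expdecay_exp (D i))).
have [[i1 i1P]|none] := pselect (exists i, (c i != 0) && (D i < b)); last first.
  right; exists b => //; apply/expdecay_coord => i j; rewrite (ord1 j).
  apply: zi; have [|ci] := eqVneq (c i) 0; first by left.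
  right; rewrite leNgt; apply/negP => Dib; apply: none; exists i.
  by rewrite ci.
left; case: (@arg_minP _ _ _ i1 (fun i => (c i != 0) && (D i < b)) D i1P).
move=> i0 /andP[ci0 Di0b] i0min.
exists i0, (\col_i (if D i == D i0 then c i else 0)); split.
- apply/eqP => /matrixP/(_ i0 0); rewrite !mxE eqxx; exact/eqP.
- by move=> i; rewrite mxE; have [//|_] := eqVneq (D i) (D i0); rewrite eqxx.
apply: sdecay_coord => i j; rewrite (ord1 j).
have [DiE|DiN] := eqVneq (D i) (D i0).
  exists b => //; apply: eq_expdecay (cP i); near=> t.
  by rewrite !mxE DiE eqxx mulrC.
apply: (@eq_sdecay _ _ _ (fun t => z t i 0)).
  by near=> t; rewrite !mxE (negbTE DiN) mulr0 subr0.
have [cb|] := boolP ((c i != 0) && (D i < b)); last first.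
  rewrite negb_and negbK -leNgt => /orP cb; exists b => //; apply: zi.
  by case: cb => [/eqP|]; auto.
have Dlt : D i0 < D i by rewrite lt_neqAle eq_sym DiN i0min.
exists (D i) => //; apply: (@eq_expdecay _ _ _ (fun t => (z t i 0 -
    c i * expR (- D i * t)) + c i * expR (- D i * t))).
  by near=> t; rewrite subrK.
apply: expdecayD; last exact: expdecayZl (expdecay_exp (D i)).
by apply: expdecay_weaken (cP i); case/andP: cb => _ /ltW.
Unshelve. all: by end_near. Qed.

(** Were there no leading term, the rate would be improved by a fixed amount at
    each step, and the solution would decay faster than any exponential,
    against [energy_not_superexponential]. *)
Lemma leading_term : has_leading_term.
Proof.
have [//|noterm] := pselect has_leading_term; exfalso.
have [a a0 za] := solution_expdecay.
have [al al0 step] := decay_bootstrap.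
have arb n : exists2 b, a * (1 + n%:R * al) <= b & expdecay z b.
  elim: n => [|n [b ab zb]]; first by exists a => //; rewrite mul0r addr0 mulr1.
  have b0 : 0 < b by apply: lt_le_trans ab; rewrite mulr_gt0// ltr_wpDr// mulr_ge0// ltW.
  have [//|[b' bb' zb']] := step _ b0 zb; exists b' => //.
  apply: le_trans (ltW bb').
  have : a * al <= b * al.
    rewrite ler_pM2r//; apply: le_trans ab; rewrite ler_peMr ?(ltW a0)// lerDl.
    by rewrite mulr_ge0// ltW.
  by rewrite -natr1; nra.
have [c [k [k0 kP]]] := energy_not_superexponential.
have [b cb zb] : exists2 b, c < b + b & expdecay z b.
  pose n := Num.truncn (`|c| / (a * al)).
  have [b ab zb] := arb n.+1; exists b => //.
  have aal : 0 < a * al by rewrite mulr_gt0.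
  have := truncnS_gt (`|c| / (a * al)); rewrite -/n ltr_pdivrMr// => h.
  have := ler_norm c; have := normr_ge0 c; nra.
have zz : expdecay energy (b + b).
  apply: (@eq_expdecay _ _ _ (fun t => \sum_i z t i 0 * z t i 0)).
    by near=> t.
  by apply: expdecay_sum => i _ _; apply: expdecayM; move/expdecay_coord: zb; apply.
have : k = 0.
  apply: (exp_coef_eq0 cb); apply: expdecay_le zz; near=> t.
  rewrite !ger0_norm ?energy_ge0// ?mulr_ge0 ?expR_ge0 ?(ltW k0)//.
  by near: t.
by move=> k00; rewrite k00 ltxx in k0.
Unshelve. all: by end_near. Qed.

End DiagonalFlow.

(** * Expansion of one homogeneous term *)

Section EnumerationFacts.
Context {R : realType} (S : set R) (mt : nat -> R).
Hypothesis S0 : S 0.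
Hypothesis S_ge0 : forall s, S s -> 0 <= s.
Hypothesis mtE : increasing_enumeration S mt.

Lemma increnum_lt : {mono mt : n p / (n < p)%N >-> n < p}.
Proof.
by apply: leW_mono; apply: le_mono => n p np; case: mtE => h _; exact: h.
Qed.

Lemma increnum_le : {mono mt : n p / (n <= p)%N >-> n <= p}.
Proof. by move=> n p; rewrite leNgt increnum_lt -leqNgt. Qed.

Lemma increnum_inj : injective mt.
Proof. by move=> n p e; apply/eqP; rewrite eqn_leq -!increnum_le e lexx. Qed.

Lemma increnum_in n : S (mt n).
Proof. by case: mtE => _ <-; exists n. Qed.

Lemma increnum_surj s : S s -> exists n, s = mt n.
Proof. by case: mtE => _ <- [n _ <-]; exists n. Qed.

Lemma increnum_ge0 n : 0 <= mt n.
Proof. exact/S_ge0/increnum_in. Qed.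

Lemma increnum0 : mt 0%N = 0.
Proof.
have [n e] := increnum_surj S0; apply/eqP; rewrite eq_le increnum_ge0 andbT e.
by rewrite increnum_le.
Qed.

Lemma increnum_gt0 n : (0 < n)%N -> 0 < mt n.
Proof. by rewrite -increnum0 increnum_lt. Qed.

(** The gap property: no element of the set lies strictly between consecutive
    terms. *)
Lemma increnum_next n s : S s -> mt n < s -> mt n.+1 <= s.
Proof. by move=> /increnum_surj[p ->]; rewrite increnum_lt increnum_le. Qed.

End EnumerationFacts.

Section TermExpansion.
Context {R : realType} {d : nat}.
Local Notation V := 'cV[R]_d.
Implicit Types (G : V -> V).

Lemma expR_sum (I : Type) (s : seq I) (f : I -> R) :
  expR (\sum_(i <- s) f i) = \prod_(i <- s) expR (f i).
Proof.
by elim: s => [|i s IH]; rewrite ?big_nil ?expR0// !big_cons expRD IH.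
Qed.

Lemma expdecay_vhorner (q : 'cV[{poly R}]_d) (e : R) :
  0 < e -> expdecay (vhorner q) (- e).
Proof.
move=> e0; apply/expdecay_coord => i j.
apply: eq_expdecay (expdecay_poly (q i j) e0); near=> t; by rewrite mxE.
Unshelve. all: by end_near. Qed.

Lemma taylor_coef_multilinear U G xi : open U -> U xi -> smooth_on U G ->
  multilinear (taylor_coef G xi).
Proof.
move=> oU Uxi GU l1 l2 a x y; rewrite /taylor_coef !size_cat /=.
rewrite (iter_diff_multilinear oU GU Uxi) scalerDr !scalerA.
by rewrite [_^-1 * a]mulrC.
Qed.

Lemma open_neq0 : open (~` [set (0 : V)]).
Proof. by rewrite openC; apply: accessible_closed_set1; exact/hausdorff_accessible/norm_hausdorff. Qed.

(** Taylor's formula at [xi], of an order [M] so large that [|h|^M] is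
    negligible; then [h] is replaced by its approximation [hbar] in the
    multilinear terms, and these are expanded. *)
Lemma term_expansion G xi (h hbar : R -> V) (N M : nat) (c : nat -> R)
    (q : nat -> 'cV[{poly R}]_d) (eta mu : R) :
  xi != 0 -> smooth_on (~` [set 0]) G ->
  hbar = (fun t => \sum_(k <- iota 1 N) expR (- c k * t) *: vhorner (q k) t) ->
  0 < eta -> 0 <= mu -> expdecay h eta -> sdecay (fun t => h t - hbar t) mu ->
  mu < M%:R * eta ->
  sdecay (fun t => G (xi + h t) -
    \sum_(w <- flatten [seq words (iota 1 N) m | m <- iota 0 M])
      expR (- (\sum_(k <- w) c k) * t) *:
        taylor_coef G xi [seq vhorner (q k) t | k <- w]) mu.
Proof.
move=> xi0 Gs hbarE eta0 mu0 hd [b mub hhbar] muM.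
have Uxi : (~` [set 0]) xi by exact/eqP.
have Tm := taylor_coef_multilinear open_neq0 Uxi Gs.
have h0 : expdecay h 0 by apply: expdecay_weaken hd; exact: ltW.
have hbar0 : expdecay hbar 0.
  apply: (@eq_expdecay _ _ _ (fun t => h t - (h t - hbar t))).
    by near=> t; rewrite opprB addrC subrK.
  apply: expdecayB => //; apply: expdecay_weaken hhbar.
  exact: le_trans mu0 (ltW mub).
pose T := taylor_coef G xi.
apply: (@eq_sdecay _ _ _ (fun t => (G (xi + h t) - \sum_(m < M) T (nseq m (h t)))
   + \sum_(m < M) (T (nseq m (h t)) - T (nseq m (hbar t))))).
  near=> t; rewrite sumrB addrA subrK; congr (_ - _).
  rewrite big_flatten big_map -(big_mkord xpredT (fun m => T (nseq m (hbar t)))).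
  rewrite /index_iota subn0; apply: eq_bigr => m _.
  have -> : hbar t = \sum_(k <- iota 1 N) expR (- c k * t) *: vhorner (q k) t.
    by rewrite hbarE.
  rewrite /T (multilinear_words _ _ _ _ Tm); apply: eq_bigr => w _.
  congr (_ *: _); rewrite -expR_sum; congr expR.
  by rewrite -sumrN mulr_suml.
apply: sdecayD; last first.
  exists b => //; apply: expdecay_sum => m _ _.
  exact: expdecay_multilinear_diff Tm h0 hbar0 hhbar.
have [r [C [r0 C0 GC]]] := taylor_bound M open_neq0 Uxi Gs.
exists (M%:R * eta) => //.
have hr := expdecay_to0 eta0 hd r0.
have [E E0 hE] := hd; exists (C * E ^+ M); first by rewrite mulr_gt0// exprn_gt0.
near=> t; apply: (@le_trans _ _ (C * `|h t| ^+ M)).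
  rewrite (_ : \sum_(m < M) _ = \sum_(m < M) m`!%:R^-1 *: iter_diff G (nseq m (h t)) xi).
    by apply: GC; near: t.
  by apply: eq_bigr => m _; rewrite /T /taylor_coef size_nseq.
rewrite -mulrA ler_pM2l//.
have -> : - (M%:R * eta) * t = M%:R * (- eta * t) by ring.
rewrite expRM_natl -exprMn lerXn2r ?nnegrE ?mulr_ge0 ?expR_ge0 ?(ltW E0)//.
by near: t.
Unshelve. all: by end_near. Qed.

End TermExpansion.

(** * Expansion of the nonlinearity along the solution *)

Definition words_upto (I : Type) (s : seq I) (M : nat) : seq (seq I) :=
  flatten [seq words s m | m <- iota 0 M].

Lemma mem_words_upto (I : eqType) (s : seq I) M (w : seq I) :
  (w \in words_upto s M) = (size w < M)%N && all (mem s) w.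
Proof.
apply/flatten_mapP/andP => [[m]|[wM ws]].
  by rewrite mem_iota add0n /= mem_words => mM /andP[/eqP -> ->].
by exists (size w); rewrite ?mem_iota// mem_words eqxx.
Qed.

Lemma uniq_words_upto (I : eqType) (s : seq I) M : uniq s -> uniq (words_upto s M).
Proof.
move=> us; rewrite /words_upto; elim: M => // M IH.
rewrite -addn1 iotaD map_cat flatten_cat cat_uniq IH /= cats0 uniq_words// andbT.
apply/hasPn => w; rewrite mem_words => /andP[/eqP wM _]; apply/negP.
by rewrite [_ \in _]mem_words_upto wM ltnn.
Qed.

Section NonlinearExpansion.
Context {R : realType} {d : nat}.
Local Notation V := 'cV[R]_d.
Context (F : V -> V) (K : option nat) (beta : nat -> R) (Fr : nat -> V -> V).
Hypothesis Fexp : expansion F K beta Fr.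
Context (lam : R) (xi : V) (S : set R) (mt : nat -> R).
Hypothesis lam_gt0 : 0 < lam.
Hypothesis xi_neq0 : xi != 0.
Hypothesis S0 : S 0.
Hypothesis S_ge0 : forall s, S s -> 0 <= s.
Hypothesis SD : forall s s', S s -> S s' -> S (s + s').
Hypothesis S_alpha : forall r, term_indices K r -> S (alpha beta r * lam).
Hypothesis mtE : increasing_enumeration S mt.
Implicit Types (q : nat -> 'cV[{poly R}]_d) (rk : nat * seq nat).

Definition term_exponent rk : R := \sum_(k <- rk.2) mt k + alpha beta rk.1 * lam.

Definition resonant_term q rk (t : R) : V :=
  taylor_coef (Fr rk.1) xi [seq vhorner (q k) t | k <- rk.2].

Definition resonant_sum q n (t : R) : V :=
  \sum_(rk \in resonant K beta lam mt n) resonant_term q rk t.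

Lemma alpha_lam_gt0 r : term_indices K r -> 0 < alpha beta r * lam.
Proof.
by move=> Kr; rewrite mulr_gt0// subr_gt0; exact: expansion_beta_gt1 Fexp Kr.
Qed.

Lemma sum_mt_ge0 (w : seq nat) : 0 <= \sum_(k <- w) mt k.
Proof. by apply: sumr_ge0 => k _; exact: (increnum_ge0 S_ge0 mtE). Qed.

Lemma term_exponent_in rk : term_indices K rk.1 -> S (term_exponent rk).
Proof.
move=> Kr; apply: SD; last exact: S_alpha.
elim: rk.2 => [|k w IH]; first by rewrite big_nil.
by rewrite big_cons; apply: SD => //; exact: (increnum_in mtE).
Qed.

(** Since [alpha_r lam > 0], the exponents of the arguments are smaller than
    [mt n]: the equation for [q_n] is explicit in the previous [q_k], and the
    induction is well founded. *)
Lemma resonant_lt n rk k : resonant K beta lam mt n rk -> k \in rk.2 -> (k < n)%N.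
Proof.
move=> [Kr _ e] kw; rewrite -(increnum_lt mtE) -e.
apply: (@le_lt_trans _ _ (\sum_(k <- rk.2) mt k)).
  elim: rk.2 kw => // l w IH; rewrite inE big_cons => /orP[/eqP ->|/IH].
    by rewrite lerDl sum_mt_ge0.
  by move=> h; apply: (le_trans h); rewrite lerDr (increnum_ge0 S_ge0 mtE).
by rewrite ltrDl alpha_lam_gt0.
Qed.

(** The entries are at least 1, so each contributes at least [mt 1] and long
    tuples are not resonant. *)
Lemma resonant_size n rk : resonant K beta lam mt n rk ->
  (size rk.2)%:R * mt 1%N <= mt n.
Proof.
move=> [Kr w1 <-]; apply: (@le_trans _ _ (\sum_(k <- rk.2) mt k)); last first.
  by rewrite lerDl ltW// alpha_lam_gt0.
elim: rk.2 w1 => [|k w IH] /=; first by rewrite big_nil mul0r.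
move=> /andP[k1 /IH h]; rewrite big_cons -natr1 mulrDl mul1r addrC lerD//.
by rewrite (increnum_le mtE).
Qed.

Lemma eq_resonant_sum q q' n t : (forall k, (k < n)%N -> q k = q' k) ->
  resonant_sum q n t = resonant_sum q' n t.
Proof.
move=> qq'; apply: eq_fsbigr => rk /set_mem rkn; rewrite /resonant_term.
congr (taylor_coef _ _ _); apply/eq_in_map => k krk.
by rewrite qq'//; exact: resonant_lt rkn krk.
Qed.

Section Truncation.
Context (N r0 M : nat).
Hypothesis r0K : forall r, (r < r0)%N -> term_indices K r.
Hypothesis r0_large : forall r, term_indices K r -> (r0 <= r)%N ->
  mt N.+1 < alpha beta r * lam.
Hypothesis M_large : mt N.+1 < M%:R * mt 1%N.

Definition candidates : seq (nat * seq nat) :=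
  [seq (r, w) | r <- iota 0 r0, w <- words_upto (iota 1 N) M].

(** The resonant tuples of the first exponents all lie in one finite list, cut
    out by the number of terms of [F] and by the order of the Taylor expansion. *)
Lemma resonant_sumE q n t : (n <= N.+1)%N ->
  resonant_sum q n t = \sum_(rk <- candidates | term_exponent rk == mt n) resonant_term q rk t.
Proof.
move=> nN; rewrite /resonant_sum (fsbigE [seq rk <- candidates | term_exponent rk == mt n]).
- rewrite big_filter_cond big_seq_cond [RHS]big_seq_cond; apply: eq_bigl => rk.
  have [|//] := boolP (rk \in candidates).
  move=> /allpairsP[[r w] [/= rr ww ->]]; have [/eqP e|//] := boolP (term_exponent _ == _).
  move: rr ww; rewrite mem_iota add0n mem_words_upto => /= rr /andP[_ ww].
  apply/mem_set; split => //=; first exact: r0K.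
  by apply/allP => k /(allP ww) /=; rewrite mem_iota => /andP[].
- rewrite filter_uniq// allpairs_uniq ?iota_uniq ?uniq_words_upto ?iota_uniq//.
  by move=> [r w] [r' w'] _ _ [-> ->].
- move=> rk /=; rewrite mem_filter => /andP[/eqP e /allpairsP[[r w] [/= rr ww rkE]]].
  move: e; rewrite rkE => e.
  move: rr ww; rewrite mem_iota add0n mem_words_upto => /= rr /andP[_ ww].
  split => //=; first exact: r0K.
  by apply/allP => k /(allP ww) /=; rewrite mem_iota => /andP[].
move=> rk rkn; rewrite mem_filter => /negP rkL; exfalso; apply: rkL.
have lt := fun k => @resonant_lt n rk k rkn; have sz := resonant_size rkn.
have [Kr w1 e] := rkn.
apply/andP; split; first by rewrite /term_exponent e.
apply/allpairsP; exists rk; split; last by case: rk {rkn lt sz Kr w1 e}.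
  rewrite mem_iota add0n /= ltnNge; apply/negP => /(r0_large Kr).
  apply/negP; rewrite -leNgt; apply: (@le_trans _ _ (mt n)).
    by rewrite -e lerDr sum_mt_ge0.
  by rewrite (increnum_le mtE).
rewrite mem_words_upto; apply/andP; split.
  have m1 : 0 < mt 1%N by exact: (increnum_gt0 S0 S_ge0 mtE).
  rewrite -(ltr_nat R) -(ltr_pM2r m1); apply: le_lt_trans sz _.
  by apply: le_lt_trans M_large; rewrite (increnum_le mtE).
apply/allP => k kw /=; rewrite mem_iota (allP w1 _ kw)/= add1n.
exact: leq_trans (lt _ kw) nN.
Qed.

End Truncation.

Lemma resonant_term_vhorner q rk : term_indices K rk.1 ->
  exists p, forall t, vhorner p t = resonant_term q rk t.
Proof.
move=> Kr; have [_ Gs] := expansion_term Fexp Kr.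
have Uxi : (~` [set 0]) xi by exact/eqP.
have [p pP] := multilinear_vhorner [seq q k | k <- rk.2]
  (taylor_coef_multilinear open_neq0 Uxi Gs).
by exists p => t; rewrite pP -map_comp.
Qed.

Lemma truncation_exists N (eta : R) : 0 < eta -> exists M : nat,
  mt N.+1 < M%:R * mt 1%N /\ mt N < M%:R * eta.
Proof.
move=> eta0; have m1 : 0 < mt 1%N by exact: (increnum_gt0 S0 S_ge0 mtE).
exists (maxn (Num.truncn (mt N.+1 / mt 1%N)).+1 (Num.truncn (mt N / eta)).+1).
rewrite -!ltr_pdivrMr//; split; apply: (lt_le_trans (truncnS_gt _));
  by rewrite ler_nat ?leq_maxl ?leq_maxr.
Qed.

Lemma expansion_cut_exists N : exists r0 : nat, exists b : R,
  [/\ mt N.+1 + lam < lam * b, forall r, (r < r0)%N -> term_indices K r,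
    forall r, term_indices K r -> (r0 <= r)%N -> mt N.+1 < alpha beta r * lam &
    exists rho C, [/\ 0 < rho, 0 < C & forall x, `|x| < rho ->
      `|F x - \sum_(k < r0) Fr k x| <= C * `|x| `^ b]].
Proof.
have B0 : 0 <= (mt N.+1 + lam) / lam.
  by rewrite divr_ge0 ?addr_ge0 ?(increnum_ge0 S_ge0 mtE) ?ltW.
have [r0 [b [bB r0K r0l FO]]] := expansion_cut B0 Fexp.
exists r0, b; split => //; first by rewrite mulrC -ltr_pdivrMr.
move=> r Kr /(r0l r Kr); rewrite ltr_pdivrMr// /alpha mulrBl mul1r.
by rewrite ltrBrDr.
Qed.

Lemma resonant_sum_vhorner q n : exists p, forall t, vhorner p t = resonant_sum q n t.
Proof.
have [r0 [b [_ r0K r0l _]]] := expansion_cut_exists n.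
have [M [M1 _]] := truncation_exists n ltr01.
have H rk : exists p, rk \in candidates n r0 M -> forall t, vhorner p t = resonant_term q rk t.
  have [rkL|] := boolP (rk \in candidates n r0 M); last by exists 0.
  have [|p pP] := @resonant_term_vhorner q rk; last by exists p.
  move/allpairsP: rkL => [[r w] [/= rr _ ->]] /=.
  by apply: r0K; move: rr; rewrite mem_iota.
have /choice [p pP] := H.
exists (\sum_(rk <- candidates n r0 M | term_exponent rk == mt n) p rk) => t.
rewrite (resonant_sumE r0K r0l M1)// vhorner_sum big_seq_cond [RHS]big_seq_cond.
by apply: eq_bigr => rk /andP[rkL _]; exact: pP.
Qed.

(** Each term [F_r] gains the factor [e^(-alpha_r lam t)], and [mt N + alpha_r
    lam], which is an exponent larger than [mt N], is at least [mt N.+1]; so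
    knowing [y] up to [mt N] suffices. The terms obtained are then sorted by
    their exponent: those equal to some [mt n] with [n <= N + 1] make up the
    resonant sums, the others are negligible. *)
Lemma nonlinear_expansion (y : R -> V) q N :
  q 0%N = map_mx polyC xi ->
  sdecay (fun t => y t - \sum_(n < N.+1) expR (- (mt n + lam) * t) *: vhorner (q n) t)
    (mt N + lam) ->
  sdecay (fun t => F (y t) - \sum_(n < N.+2)
    expR (- (mt n + lam) * t) *: resonant_sum q n t) (mt N.+1 + lam).
Proof.
move=> q0 yd.
pose h t := expR (lam * t) *: y t - xi.
pose hbar t := \sum_(k <- iota 1 N) expR (- mt k * t) *: vhorner (q k) t.
have mtN0 := increnum_ge0 S_ge0 mtE N.
(* the term of index 0 is [e^(-lam t) xi], removed in [h] *)
have hhbar : sdecay (fun t => h t - hbar t) (mt N).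
  have := sdecayZ (expdecay_exp (- lam)) yd; rewrite addrCA addNr addr0.
  apply: eq_sdecay; near=> t.
  rewrite opprK scalerBr /h -addrA; congr (_ + _); rewrite -opprD; congr (- _).
  rewrite scaler_sumr big_ord_recl/=; congr (_ + _).
    rewrite (increnum0 S0 S_ge0 mtE) add0r scalerA -expRD mulNr addrN expR0 scale1r q0.
    by apply/matrixP => i j; rewrite !mxE hornerC.
  have -> : hbar t = \sum_(1 <= k < N.+1) expR (- mt k * t) *: vhorner (q k) t.
    by rewrite /index_iota subn1.
  rewrite big_add1/= big_mkord.
  apply: eq_bigr => k _; rewrite scalerA -expRD; congr (expR _ *: _).
  by rewrite /bump/= add1n; ring.
have hbard : sdecay hbar 0.
  apply: sdecay_sum => k; rewrite mem_iota => /andP[k1 _] _.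
  apply: sdecay_expZ; first exact: expdecay_vhorner.
  exact: (increnum_gt0 S0 S_ge0 mtE).
have [eta eta0 hd] : sdecay h 0.
  apply: (@eq_sdecay _ _ _ (fun t => (h t - hbar t) + hbar t)).
    by near=> t; rewrite subrK.
  by apply: sdecayD => //; exact: sdecay_weaken hhbar.
have yE t : y t = expR (- lam * t) *: (xi + h t).
  by rewrite /h addrC subrK scalerA -expRD mulNr addNr expR0 scale1r.
have ydlam : expdecay y lam.
  have : expdecay (fun t => xi + h t) 0.
    apply: expdecayD; first exact: expdecay_cst.
    by apply: expdecay_weaken hd; exact: ltW.
  move=> /(expdecayZ (expdecay_exp lam)); rewrite addr0.
  by apply: eq_expdecay; near=> t.
have [M [M1 M2]] := truncation_exists N eta0.
have [r0 [b [bB r0K r0l [rho [C [rho0 C0 FO]]]]]] := expansion_cut_exists N.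
have b0 : 0 < b.
  rewrite -(pmulr_rgt0 _ lam_gt0); apply: lt_trans bB.
  by rewrite ltr_wpDl// (increnum_ge0 S_ge0 mtE).
pose L := candidates N r0 M.
pose tm rk t := expR (- (term_exponent rk + lam) * t) *: resonant_term q rk t.
have rem0 : sdecay (fun t => F (y t) - \sum_(k < r0) Fr k (y t)) (mt N.+1 + lam).
  by exists (lam * b) => //; exact: (expdecay_powR lam_gt0 b0 rho0 C0 FO ydlam).
have rem1 r : r \in iota 0 r0 -> sdecay (fun t => Fr r (y t) -
    \sum_(w <- words_upto (iota 1 N) M) tm (r, w) t) (mt N.+1 + lam).
  rewrite mem_iota add0n => /andP[_ rr]; have Kr := r0K r rr.
  have [Gb Gs] := expansion_term Fexp Kr.
  have := term_expansion xi_neq0 Gs (erefl hbar) eta0 mtN0 hd hhbar M2.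
  move=> /(sdecayZ (expdecay_exp (lam * beta r))) hr.
  apply: (@sdecay_weaken _ _ _ (lam * beta r + mt N)).
    have al0 := alpha_lam_gt0 Kr.
    have : mt N.+1 <= mt N + alpha beta r * lam.
      apply: (increnum_next mtE); last by rewrite ltrDl.
      by apply: SD; [exact: (increnum_in mtE)|exact: S_alpha].
    by rewrite /alpha => h1; lra.
  apply: eq_sdecay hr; near=> t.
  rewrite scalerBr; congr (_ - _).
    by rewrite {1}yE (Gb _ _ (expR_gt0 _)) -expRM; congr (expR _ *: _); ring.
  rewrite scaler_sumr; apply: eq_bigr => w _.
  rewrite /tm [RHS]scalerA -expRD; congr (expR _ *: _).
  by rewrite /term_exponent/= /alpha; ring.
(* the terms whose exponent exceeds [mt N.+1]; the inner sum has one term or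
   none *)
have rem2 rk : rk \in L ->
    sdecay (fun t => tm rk t - \sum_(n < N.+2 | term_exponent rk == mt n) tm rk t) (mt N.+1 + lam).
  move=> rkL; have Kr : term_indices K rk.1.
    move/allpairsP: rkL => [[r w] [/= rr _ ->]] /=.
    by apply: r0K; move: rr; rewrite mem_iota.
  have [n pn] := increnum_surj mtE (term_exponent_in Kr).
  have [nN|Nn] := ltnP n N.+2.
    apply: (eq_sdecay _ (sdecay0 _ _)); near=> t.
    rewrite (big_pred1 (Ordinal nN)) ?subrr// => k.
    rewrite pn; apply/eqP/eqP => [e|-> //];
      apply/val_inj => /=; exact: esym (increnum_inj mtE e).
  apply: (@eq_sdecay _ _ _ (tm rk)).
    near=> t; rewrite big_pred0 ?subr0// => k.
    by rewrite pn; apply/eqP => /(increnum_inj mtE) e;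
      move: (ltn_ord k); rewrite -e ltnNge Nn.
  have [p pE] := resonant_term_vhorner q Kr.
  apply: (@eq_sdecay _ _ _ (fun t => expR (- (term_exponent rk + lam) * t) *: vhorner p t)).
    by near=> t; rewrite pE.
  apply: sdecay_expZ; first exact: expdecay_vhorner.
  by rewrite ltrD2r pn (increnum_lt mtE).
apply: (@eq_sdecay _ _ _ (fun t => (F (y t) - \sum_(k < r0) Fr k (y t)) +
  \sum_(r <- iota 0 r0) (Fr r (y t) - \sum_(w <- words_upto (iota 1 N) M) tm (r, w) t) +
  \sum_(rk <- L) (tm rk t - \sum_(n < N.+2 | term_exponent rk == mt n) tm rk t))); last first.
  apply: sdecayD; last by apply: sdecay_sum => rk rkL _; exact: rem2.
  by apply: sdecayD => //; apply: sdecay_sum => r rr _; exact: rem1.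
near=> t.
rewrite !sumrB -(big_mkord xpredT (fun k => Fr k (y t))) /index_iota subn0.
rewrite [RHS]addrA [_ - _ + (_ - _)]addrA subrK.
rewrite [X in _ + X - _]big_allpairs_dep/= subrK; congr (_ - _).
rewrite (exchange_big_dep xpredT)//=; apply: eq_bigr => n _.
rewrite (resonant_sumE r0K r0l M1); last by rewrite -ltnS.
rewrite scaler_sumr; apply: eq_bigr => rk /eqP e.
by rewrite /tm e.
Unshelve. all: by end_near. Qed.

End NonlinearExpansion.

(** * Induction on the number of terms *)

Section PolynomialVectors.
Context {R : realType} {d : nat}.

Lemma vhorner_mulmx (P : 'M[R]_d) (p : 'cV[{poly R}]_d) t :
  vhorner (map_mx polyC P *m p) t = P *m vhorner p t.
Proof.
apply/matrixP => i j; rewrite !mxE horner_sum; apply: eq_bigr => k _.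
by rewrite !mxE hornerM hornerC.
Qed.

Lemma vderiv_mulmx (P : 'M[R]_d) (p : 'cV[{poly R}]_d) :
  vderiv (map_mx polyC P *m p) = map_mx polyC P *m vderiv p.
Proof.
apply/matrixP => i j; rewrite !mxE raddf_sum; apply: eq_bigr => k _.
by rewrite /= !mxE derivM derivC mul0r add0r.
Qed.

Lemma is_derive_mulmx (P : 'M[R]_d) (y : R -> 'cV[R]_d) (t : R) dy i j :
  is_derive t (1 : R) y dy ->
  is_derive t (1 : R) (fun s => (P *m y s) i j) ((P *m dy) i j).
Proof.
move=> ydy.
have -> : (fun s => (P *m y s) i j) = \sum_k (fun s => P i k * y s k j).
  by apply/funext => s; rewrite fct_sumE mxE.
have h (k : 'I_d) := @is_deriveZ _ _ _ _ (P i k) _ _ _ (is_derive_coord k j ydy).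
have := @is_derive_sum _ _ _ d _ t 1 _ h.
by move/is_derive_eq; apply; rewrite mxE.
Qed.

End PolynomialVectors.

Section InductionStep.
Context {R : realType} {d : nat}.
Local Notation V := 'cV[R]_d.
Context (F : V -> V) (K : option nat) (beta : nat -> R) (Fr : nat -> V -> V).
Hypothesis Fexp : expansion F K beta Fr.
Context (lam : R) (xi : V) (S : set R) (mt : nat -> R).
Hypothesis lam_gt0 : 0 < lam.
Hypothesis xi_neq0 : xi != 0.
Hypothesis S0 : S 0.
Hypothesis S_ge0 : forall s, S s -> 0 <= s.
Hypothesis SD : forall s s', S s -> S s' -> S (s + s').
Hypothesis S_alpha : forall r, term_indices K r -> S (alpha beta r * lam).
Hypothesis mtE : increasing_enumeration S mt.
Context (A P : 'M[R]_d) (D : 'rV[R]_d).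
Hypothesis P_unit : P \in unitmx.
Hypothesis PA : P *m A = diag_mx D *m P.
Hypothesis S_gap : forall i, lam < D 0 i -> S (D 0 i - lam).
Context (y : R -> V).
Hypothesis y_ode : forall t : R, 0 < t -> is_derive t (1 : R) y (- (A *m y t) + F (y t)).
Implicit Types (q : nat -> 'cV[{poly R}]_d).
Local Notation mu n := (mt n + lam).
Local Notation J := (resonant_sum K beta Fr lam xi mt).

Definition solves_resonant q n := forall t,
  vhorner (vderiv (q n)) t + (A - (mu n)%:M) *m vhorner (q n) t = J q n t.

Definition approximates q N :=
  sdecay (fun t => y t - \sum_(n < N.+1) expR (- mu n * t) *: vhorner (q n) t) (mu N).

Lemma diag_coord (c : R) (v : V) i :
  (P *m ((A - c%:M) *m v)) i 0 = (D 0 i - c) * (P *m v) i 0.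
Proof.
rewrite mulmxA mulmxBr PA mul_mx_scalar mulmxBl -scalemxAl -mulmxA mul_diag_mx.
by rewrite !mxE mulrBl.
Qed.

(** In the diagonalizing coordinates each component of the remainder satisfies
    the hypotheses of [scalar_resonance_step]: an eigenvalue above [lam]
    exceeds it by an element of [S], so none lies strictly between the rates of
    orders [N] and [N + 1]. The polynomial vector works for every sequence
    extending [q], which is the form that dependent choice needs. *)
Lemma expansion_step q N : q 0%N = map_mx polyC xi ->
  (forall n, (n <= N)%N -> solves_resonant q n) -> approximates q N ->
  exists p, forall q', (forall n, (n <= N)%N -> q' n = q n) -> q' N.+1 = p ->
    solves_resonant q' N.+1 /\ approximates q' N.+1.
Proof.
move=> q0 qsol qapp.
have Fdec := nonlinear_expansion Fexp lam_gt0 xi_neq0 S0 S_ge0 SD S_alpha mtE q0 qapp.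
have [p1 p1E] := resonant_sum_vhorner Fexp lam_gt0 xi_neq0 S0 S_ge0 mtE q N.+1.
pose r n (i : 'I_d) : {poly R} := (map_mx polyC P *m q n) i 0.
pose p2 (i : 'I_d) : {poly R} := (map_mx polyC P *m p1) i 0.
have rE n i t : (r n i).[t] = (P *m vhorner (q n) t) i 0.
  by rewrite -vhorner_mulmx mxE.
have p2E i t : (p2 i).[t] = (P *m J q N.+1 t) i 0.
  by rewrite -p1E -vhorner_mulmx mxE.
have rsol n i t : (n <= N)%N ->
    (r n i)^`().[t] + (D 0 i - mu n) * (r n i).[t] = (P *m J q n t) i 0.
  move=> nN; rewrite -(qsol n nN t) mulmxDr mxE diag_coord -rE; congr (_ + _).
  by rewrite -vhorner_mulmx -vderiv_mulmx [RHS]mxE [in RHS]mxE.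
pose w i t := (P *m y t) i 0 - \sum_(n < N.+1) expR (- mu n * t) * (r n i).[t].
have wE i t : w i t =
    (P *m (y t - \sum_(n < N.+1) expR (- mu n * t) *: vhorner (q n) t)) i 0.
  rewrite mulmxBr mulmx_sumr [RHS]mxE [X in _ + X]mxE summxE; congr (_ - _).
  by apply: eq_bigr => n _; rewrite -scalemxAr mxE rE.
pose rem t := F (y t) - \sum_(n < N.+2) expR (- mu n * t) *: J q n t.
pose g i t := (P *m rem t) i 0.
have gd i : sdecay (g i) (mu N.+1).
  have [b bmu /(expdecay_mulmx P)/expdecay_coord gb] := Fdec.
  by exists b => //; exact: gb.
have w_ode i : \forall t \near +oo, is_derive t (1 : R) (w i)
    (- D 0 i * w i t + (expR (- mu N.+1 * t) * (p2 i).[t] + g i t)).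
  near=> t; have t0 : 0 < t by near: t; exact: nbhs_pinfty_gt.
  have dz := is_derive_mulmx P i 0 (y_ode t0).
  have h (n : 'I_N.+1) := @is_deriveM _ _ _ _ _ _ _ _
    (is_derive_expRM (- mu n) t) (is_derive_poly (r n i) t).
  have := @is_deriveB _ _ _ _ _ _ _ _ _ dz (@is_derive_sum _ _ _ N.+1 _ t 1 _ h).
  have -> : (fun s => (P *m y s) i 0) - \sum_(n < N.+1)
      ((fun s => expR (- mu n * s)) * horner (r n i)) = w i.
    by apply/funext => s; rewrite /w !fctE fct_sumE.
  move/is_derive_eq; apply.
  have e1 : (P *m (- (A *m y t) + F (y t))) i 0 =
      - D 0 i * (P *m y t) i 0 + (P *m F (y t)) i 0.
    have := diag_coord 0 (y t) i; rewrite raddf0 !subr0 => e.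
    by rewrite mulmxDr mulmxN [LHS]mxE [X in X + _]mxE e mulNr.
  have e2 : g i t = (P *m F (y t)) i 0 -
      \sum_(n < N.+1) expR (- mu n * t) * (P *m J q n t) i 0
      - expR (- mu N.+1 * t) * (p2 i).[t].
    rewrite /g /rem mulmxBr mulmx_sumr [LHS]mxE [X in _ + X]mxE summxE.
    rewrite big_ord_recr/= opprD addrA p2E; congr (_ - _ - _).
      by apply: eq_bigr => n _; rewrite -scalemxAr mxE.
    by rewrite -scalemxAr mxE.
  rewrite e1 e2 /w mulrBr mulr_sumr.
  have -> : \sum_(n < N.+1) (expR (- mu n * t) *: (r n i)^`().[t] +
       (r n i).[t] *: (- mu n * expR (- mu n * t))) =
     \sum_(n < N.+1) (expR (- mu n * t) * (P *m J q n t) i 0) +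
     \sum_(n < N.+1) (- D 0 i * (expR (- mu n * t) * (r n i).[t])).
    rewrite -big_split/=; apply: eq_bigr => n _.
    rewrite -rsol; last by rewrite -ltnS.
    by rewrite /GRing.scale/=; ring.
  by ring.
have [a amu ya] := qapp.
have wa i : expdecay (w i) a.
  have /(expdecay_mulmx P)/expdecay_coord h := ya.
  by apply: eq_expdecay (h i 0); near=> t; exact: wE.
have gap i : D 0 i < a \/ mu N.+1 <= D 0 i.
  have [Dmu|muD] := leP (D 0 i) (mu N); first by left; exact: le_lt_trans amu.
  right; rewrite -lerBrDr; apply: (increnum_next mtE).
    by apply: S_gap; apply: le_lt_trans muD; rewrite lerDr (increnum_ge0 S_ge0 mtE).
  by rewrite ltrBrDr.
have /choice [qd qdP] : forall i, exists qi : {poly R},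
    qi^`() + (D 0 i - mu N.+1) *: qi = p2 i /\
    sdecay (fun t => w i t - expR (- mu N.+1 * t) * qi.[t]) (mu N.+1).
  move=> i; have [qi h1 h2] := scalar_resonance_step (gap i) (wa i) (gd i) (w_ode i).
  by exists qi.
pose p := map_mx polyC (invmx P) *m (\col_i qd i).
have Pp t : P *m vhorner p t = \col_i (qd i).[t].
  rewrite vhorner_mulmx mulKVmx//; by apply/matrixP => i j; rewrite !mxE.
have Pdp t : P *m vhorner (vderiv p) t = \col_i (qd i)^`().[t].
  rewrite vderiv_mulmx vhorner_mulmx mulKVmx//.
  by apply/matrixP => i j; rewrite !mxE.
exists p => q' q'q q'p; split.
  move=> t; rewrite q'p; have -> : J q' N.+1 t = J q N.+1 t.
    by apply: (eq_resonant_sum Fexp xi lam_gt0 S_ge0 mtE) => k kN; exact: q'q.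
  apply: (can_inj (mulKmx P_unit)); apply/matrixP => i j; rewrite (ord1 j).
  rewrite mulmxDr [LHS]mxE diag_coord Pp Pdp -p2E.
  by have [<- _] := qdP i; rewrite hornerD hornerZ !mxE.
apply: (@eq_sdecay _ _ _ (fun t => invmx P *m (\col_i (w i t -
    expR (- mu N.+1 * t) * (qd i).[t])))).
  near=> t; apply: (can_inj (mulKmx P_unit)); rewrite mulKVmx//.
  rewrite big_ord_recr/= q'p opprD addrA mulmxBr -scalemxAr Pp.
  have -> : \sum_(n < N.+1) expR (- mu n * t) *: vhorner (q' n) t =
      \sum_(n < N.+1) expR (- mu n * t) *: vhorner (q n) t.
    by apply: eq_bigr => n _; rewrite q'q// -ltnS.
  apply/matrixP => i j; rewrite (ord1 j) [RHS]mxE wE [LHS]mxE; congr (_ + _).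
  by rewrite !mxE.
apply: sdecay_mulmx; apply: sdecay_coord => i j; rewrite (ord1 j).
have [_ h] := qdP i; by apply: eq_sdecay h; near=> t; rewrite mxE.
Unshelve. all: by end_near. Qed.

Lemma eq_solves q q' n : (forall k, (k <= n)%N -> q k = q' k) ->
  solves_resonant q n -> solves_resonant q' n.
Proof.
move=> qq' qn t; rewrite -qq'// qn.
by apply: (eq_resonant_sum Fexp xi lam_gt0 S_ge0 mtE) => k kn; exact/qq'/ltnW.
Qed.

Lemma eq_approximates q q' N : (forall k, (k <= N)%N -> q k = q' k) ->
  approximates q N -> approximates q' N.
Proof.
move=> qq'; apply: eq_sdecay; near=> t; congr (_ - _).
by apply: eq_bigr => n _; rewrite qq'// -ltnS.
Unshelve. all: by end_near. Qed.

(** [Q N] is the sequence known after [N] steps; it is modified only at index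
    [N + 1] afterwards, so its diagonal extends every [Q N]. *)
Lemma full_expansion : A *m xi = lam *: xi ->
  sdecay (fun t => y t - expR (- lam * t) *: xi) lam ->
  exists q, forall N, solves_resonant q N /\ approximates q N.
Proof.
move=> Axi yxi; pose c := map_mx polyC xi.
have cE t : vhorner c t = xi by apply/matrixP => i j; rewrite !mxE hornerC.
pose inv q N := [/\ q 0%N = c, forall n, (n <= N)%N -> solves_resonant q n &
  approximates q N].
have [nxt nxtP] : exists nxt : (nat -> 'cV[{poly R}]_d) * nat -> 'cV[{poly R}]_d,
    forall q N q', inv q N -> (forall n, (n <= N)%N -> q' n = q n) ->
    q' N.+1 = nxt (q, N) -> solves_resonant q' N.+1 /\ approximates q' N.+1.
  have H (qN : (nat -> 'cV[{poly R}]_d) * nat) : exists p, inv qN.1 qN.2 ->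
      forall q', (forall n, (n <= qN.2)%N -> q' n = qN.1 n) -> q' qN.2.+1 = p ->
      solves_resonant q' qN.2.+1 /\ approximates q' qN.2.+1.
    have [[q0 qs qa]|ninv] := pselect (inv qN.1 qN.2); last by exists 0 => /ninv.
    by have [p pP] := expansion_step q0 qs qa; exists p.
  have /choice [nxt nxtP] := H; exists nxt => q N q' qinv q'q q'N.
  exact: (nxtP (q, N) qinv q' q'q q'N).
pose Q := fix Q N := if N is N'.+1 then
  (fun n => if n == N'.+1 then nxt (Q N', N') else Q N' n) else fun=> c.
pose q n := Q n n.
have Qq N n : (n <= N)%N -> Q N n = q n.
  elim: N => [|N IH]; first by rewrite leqn0 => /eqP ->.
  rewrite leq_eqVlt => /orP[/eqP -> //|nN] /=.
  by rewrite ltn_eqF// IH.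
have qinv N : inv q N.
  elim: N => [|N [q0 qs qa]].
    split=> //.
      move=> n; rewrite leqn0 => /eqP -> t; rewrite /q/= cE.
      have -> : vderiv c = 0.
        by apply/matrixP => i j; rewrite !mxE derivC.
      rewrite (increnum0 S0 S_ge0 mtE) add0r mulmxBl Axi mul_scalar_mx subrr addr0.
      rewrite /resonant_sum (_ : resonant _ _ _ _ _ = set0) ?fsbig_set0.
        by apply/matrixP => i j; rewrite !mxE horner0.
      apply/seteqP; split => // rk rk0; have [Kr _ e] := rk0.
      have := alpha_lam_gt0 Fexp lam_gt0 Kr; have := sum_mt_ge0 S_ge0 mtE rk.2.
      by move: e; rewrite (increnum0 S0 S_ge0 mtE); lra.
    rewrite /approximates (increnum0 S0 S_ge0 mtE) add0r; apply: eq_sdecay yxi; near=> t.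
    by rewrite big_ord_recl big_ord0 addr0/= (increnum0 S0 S_ge0 mtE) add0r /q/= cE.
  have Qinv : inv (Q N) N.
    split; first by rewrite Qq.
      move=> n nN; apply: eq_solves (qs n nN) => k kn.
      by rewrite Qq// (leq_trans kn).
    by apply: eq_approximates qa => k kN; rewrite Qq.
  have [||s a] := nxtP (Q N) N q Qinv.
  - by move=> n nN; rewrite Qq.
  - by rewrite /q /= eqxx.
  split=> // n; rewrite leq_eqVlt ltnS => /orP[/eqP -> //|]; exact: qs.
exists q => N; have [_ qs qa] := qinv N; split=> //; exact: qs.
Unshelve. all: by end_near. Qed.

End InductionStep.

(** * Solutions on the half-line *)

Section Solution.
Context {R : realType} {d : nat}.
Local Notation V := 'cV[R]_d.

(** At [t > 0] the one-sided condition on the increments holds automatically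
    for small increments. *)
Lemma C1_halfline_is_derive (y : R -> V) (t : R) : C1_halfline y -> 0 < t ->
  is_derive t (1 : R) y (derive1 y t).
Proof.
move=> [dy [_ dyP]] t0; have := dyP t (ltW t0) => yt.
rewrite derive1E; apply: derivableP; apply/cvg_ex; exists (dy t) => U /yt.
rewrite /nbhs/= => UP.
have near0 : \forall h \near (0 : R)^', 0 <= h + t.
  near=> h; have : `|h| < t by near: h; exact: dnbhs0_lt.
  by rewrite ltr_norml => /andP[h1 _]; rewrite -lerBlDr sub0r ltW.
apply: filterS2 near0 UP => h h0 /(_ h0).
by rewrite /= [h *: _]mulr1.
Unshelve. all: by end_near. Qed.

Lemma C1_halfline_right_continuous (y : R -> V) : C1_halfline y ->
  forall e : R, 0 < e -> exists2 r : R, 0 < r &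
    forall t, 0 <= t < r -> `|y t - y 0| < e.
Proof.
move=> [dy [_ /(_ 0 (lexx _)) dy0]] e e0.
have : nbhs (dy 0) (ball (dy 0) 1) by exact: nbhsx_ballx.
move=> /dy0; rewrite /nbhs/= => -[r /= r0 rP].
pose b := `|dy 0| + 1; have b0 : 0 < b by rewrite ltr_wpDl.
exists (Num.min r (e / b)); first by rewrite lt_min r0 divr_gt0.
move=> t; rewrite lt_min => /and3P[t0 tr te].
have [->|tn0] := eqVneq t 0; first by rewrite subrr normr0.
have tpos : 0 < t by rewrite lt_neqAle eq_sym tn0.
have := rP t; rewrite /= sub0r normrN ger0_norm// addr0 => /(_ tr tn0 t0).
rewrite -ball_normE /= distrC => h.
have : `|t^-1 *: (y t - y 0)| <= b.
  rewrite -[X in `|X|](subrK (dy 0)) addrC (le_trans (ler_normD _ _))// lerD2l.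
  exact: ltW.
rewrite normrZ normfV gtr0_norm// ler_pdivrMl// => h2.
by apply: (le_lt_trans h2); rewrite -ltr_pdivlMr.
Qed.

Lemma sdecay_bigO_atoo (f : R -> V) (a : R) : sdecay f a ->
  exists2 e : R, 0 < e & bigO_atoo f (fun t => expR (- (a + e) * t)).
Proof.
move=> [b ab [C C0 fC]]; exists (b - a); first by rewrite subr_gt0.
exists ((d%:R + 1) * C); first by rewrite mulr_gt0// ltr_wpDl.
near=> t; rewrite [a + _]addrC subrK.
apply: (le_trans (enorm_le_norm _)).
rewrite -mulrA; apply: ler_pM => //; first by rewrite lerDl.
by near: t.
Unshelve. all: by end_near. Qed.

Lemma diagonalizable_diag_mx (A : 'M[R]_d) : diagonalizable A ->
  exists P D, P \in unitmx /\ P *m A = diag_mx D *m P.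
Proof.
move=> [P Pu /diag_mxP[D DE]]; exists P, D; split=> //.
by apply/similarP => //; rewrite /similar_to/= DE.
Qed.

Lemma diag_eigenvalue (A P : 'M[R]_d) (D : 'rV[R]_d) i : P \in unitmx ->
  P *m A = diag_mx D *m P -> eigenvalue A (D 0 i).
Proof.
move=> Pu PA; apply/eigenvalueP; exists (row i P).
  by rewrite -row_mul PA mul_diag_mx; apply/rowP => j; rewrite !mxE.
apply/eqP => rP.
have : row i (P *m invmx P) = 0 by rewrite row_mul rP mul0mx.
rewrite mulmxV// => /rowP/(_ i); rewrite !mxE eqxx => /eqP.
by rewrite oner_eq0.
Qed.

End Solution.

Theorem theorem4p3 (R : realType) (d : nat) (hd : (0 < d)%N)
    (A : 'M[R]_d) (hA : diagonalizable A)
    (dstar : nat) (lam : 'I_dstar -> R)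
    (hlam_pos : forall k, 0 < lam k)
    (hlam_incr : forall k l : 'I_dstar, (k < l)%N -> lam k < lam l)
    (hlam_eig : forall a : R, eigenvalue A a <-> exists k, a = lam k)
    (F : 'cV[R]_d -> 'cV[R]_d) (hF : locally_lipschitz F) (hF0 : F 0 = 0)
    (K : option nat) (beta : nat -> R) (Fr : nat -> 'cV[R]_d -> 'cV[R]_d)
    (hFexp : expansion F K beta Fr)
    (y : R -> 'cV[R]_d) (hyC1 : C1_halfline y)
    (hyode : forall t : R, 0 < t -> derive1 y t + A *m y t = F (y t))
    (hy0 : y 0 != 0) (hylim : y t @[t --> +oo] --> (0 : 'cV[R]_d)) :
  exists (n0 : 'I_dstar) (xi : 'cV[R]_d),
    [/\ A *m xi = lam n0 *: xi,
        xi != 0,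
        exists2 delta : R, 0 < delta &
          bigO_atoo (fun t => y t - expR (- lam n0 * t) *: xi)
                    (fun t => expR (- (lam n0 + delta) * t))
      & exists (mutilde : nat -> R) (q : nat -> 'cV[{poly R}]_d),
          let mu n := mutilde n + lam n0 in
          [/\ increasing_enumeration (Stilde lam n0 K beta) mutilde,
              forall N : nat, exists2 eps : R, 0 < eps &
                bigO_atoo
                  (fun t => y t - \sum_(n < N.+1)
                                    expR (- mu n * t) *: vhorner (q n) t)
                  (fun t => expR (- (mu N + eps) * t))
            & forall (n : nat) (t : R),
                vhorner (vderiv (q n)) t + (A - (mu n)%:M) *m vhorner (q n) t
                = \sum_(rk \in resonant K beta (lam n0) mutilde n)
                    taylor_coef (Fr rk.1) xi
                      [seq vhorner (q k) t | k <- rk.2]]].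
Proof.
have [P [D [Pu PA]]] := diagonalizable_diag_mx hA.
have Dlam i : exists k, D 0 i = lam k.
  by apply/hlam_eig; exact: diag_eigenvalue Pu PA.
have Dpos i : 0 < D 0 i by have [k ->] := Dlam i.
have y_ode (t : R) : 0 < t -> is_derive t (1 : R) y (- (A *m y t) + F (y t)).
  move=> t0; have := C1_halfline_is_derive hyC1 t0.
  by move/is_derive_eq; apply; rewrite -hyode// addrC addrK.
have [c c0 cP] := mulmx_norm_bound P.
have ylim (r : R) : 0 < r -> \forall t \near +oo, `|y t| < r.
  move=> r0; have /cvgrPdist_lt/(_ r r0) := hylim.
  by apply: filterS => t; rewrite sub0r normrN.
pose f (x : 'cV[R]_d) := P *m F (invmx P *m x).
pose z t := P *m y t.
have fs : superlinear f := superlinear_mulmx P (invmx P) (expansion_superlinear hFexp).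
have z_ode (t : R) : 0 < t -> forall i,
    is_derive t (1 : R) (fun s => z s i 0) (- D 0 i * z t i 0 + f (z t) i 0).
  move=> t0 i; have := is_derive_mulmx P i 0 (y_ode t t0).
  move/is_derive_eq; apply; rewrite /f /z mulKmx// mulmxDr [LHS]mxE; congr (_ + _).
  by rewrite mulmxN mulmxA PA -mulmxA mul_diag_mx mxE [X in - X]mxE mulNr.
have z_lim (r : R) : 0 < r -> \forall t \near +oo, `|z t| < r.
  move=> r0; have := ylim (r / c) (divr_gt0 r0 c0); apply: filterS => t.
  by rewrite ltr_pdivlMr// mulrC; apply: le_lt_trans; exact: cP.
have z0 : z 0 != 0.
  by apply: contra_neq hy0 => z0; rewrite -(mulKmx Pu (y 0)) -/(z 0) z0 mulmx0.
have zr (e : R) : 0 < e -> exists2 r : R, 0 < r &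
    forall t, 0 <= t < r -> `|z t - z 0| < e.
  move=> e0.
  have [r r0 rP] := C1_halfline_right_continuous hyC1 (divr_gt0 e0 c0).
  exists r => // t /rP; rewrite ltr_pdivlMr// mulrC /z -mulmxBr.
  by apply: le_lt_trans; exact: cP.
have [i0 [x [x0 xD zx]]] := leading_term (D := fun i => D 0 i) Dpos fs z_ode z_lim z0 zr.
have [n0 Dn0] := Dlam i0; rewrite {}Dn0 in xD zx.
pose xi := invmx P *m x.
have Axi : A *m xi = lam n0 *: xi.
  apply: (can_inj (mulKmx Pu)); rewrite mulmxA PA -mulmxA -scalemxAr !mulKVmx//.
  rewrite mul_diag_mx; apply/matrixP => i j; rewrite (ord1 j) !mxE.
  by have [->|/xD ->//] := eqVneq (x i 0) 0; rewrite !mulr0.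
have xi0 : xi != 0.
  by apply: contra_neq x0 => xi0; rewrite -(mulKVmx Pu x) -/xi xi0 mulmx0.
have yxi : sdecay (fun t => y t - expR (- lam n0 * t) *: xi) (lam n0).
  apply: (eq_sdecay _ (sdecay_mulmx (invmx P) zx)); near=> t.
  by rewrite mulmxBr mulKmx// -scalemxAr.
have alpha_pos r : term_indices K r -> 0 < alpha beta r.
  by move=> Kr; rewrite subr_gt0; exact: expansion_beta_gt1 hFexp Kr.
have l0 := hlam_pos n0.
pose S := Stilde lam n0 K beta.
have S0 : S 0 := Stilde0 lam n0 K beta.
have Sge s : S s -> 0 <= s := @Stilde_ge0 _ _ _ _ _ _ hlam_pos hlam_incr alpha_pos s.
have SD s s' : S s -> S s' -> S (s + s') := @StildeD _ _ _ _ _ _ s s'.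
have Salpha r : term_indices K r -> S (alpha beta r * lam n0) :=
  @Stilde_alpha _ _ _ _ _ _ r.
have Sgap i : lam n0 < D 0 i -> S (D 0 i - lam n0).
  have [k ->] := Dlam i => lk; apply: Stilde_lam; rewrite leqNgt; apply/negP.
  by move=> /hlam_incr /(lt_trans lk); rewrite ltxx.
have [r1 Kr1] : exists r, term_indices K r.
  have [r0 [b [_ _ _ _]]] := expansion_cut ler01 hFexp.
  move: hFexp; case: (K) => [Nstar|] /=; last by exists 0%N.
  by case=> N0 *; exists 0%N.
have [mt mtE] : exists mt, increasing_enumeration S mt.
  apply: locally_finite_enumeration; last first.
    move=> b; exact: (Stilde_unbounded n0 hlam_pos alpha_pos b Kr1).
  apply: Stilde_locally_finite => // b.
  have [r0 [b' [_ _ r0P _]]] := expansion_cut (normr_ge0 (b / lam n0 + 1)) hFexp.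
  exists r0 => r Kr /(r0P r Kr) h; rewrite -ltr_pdivrMr// /alpha ltrBrDr.
  exact: le_lt_trans (ler_norm _) h.
have [q qP] := full_expansion hFexp l0 xi0 S0 Sge SD Salpha mtE Pu PA Sgap y_ode Axi yxi.
exists n0, xi; split=> //; first exact: sdecay_bigO_atoo.
exists mt, q; split=> //.
  by move=> N; have [_ /sdecay_bigO_atoo] := qP N.
by move=> n t; have [-> _] := qP n.
Unshelve. all: by end_near. Qed.
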